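(* Let $P$ be the transition matrix of an irreducible and aperiodic $M$-state Markov chain, let $\beta>0$, and let $\eta$ be the type-II error exponent for testing $\mathcal{H}_0$ against $\mathcal{H}_1$ (as defined in the context). Let $$\widetilde\varphi(\beta)=\lim_{N\to\infty}\frac1N\,\mathbb{E}\log\Big(\sum_{s\in\{1,\dots,M\}^N}P(s)\exp(\beta x_s)\Big),$$ the limit being assumed to exist, where for each $N$ the family $(x_s)_{s\in\{1,\dots,M\}^N}$ consists of i.i.d. $\mathcal{N}(0,N)$ random variables. Then $$\eta\ge\frac{\beta^2}{2}-\widetilde\varphi(\beta).$$
   Context: Let $\pi$ be the unique stationary distribution of $P=[p_{i,j}]$, and for $s=(s_1,\dots,s_N)$ let $P(s)=\pi_{s_1}p_{s_1,s_2}\cdots p_{s_{N-1},s_N}$. The data are $Y^N=[y_{m,n}]$, $1\le m\le M$, $1\le n\le N$. Under $\mathcal{H}_0$ the $y_{m,n}$ are i.i.d. $\mathcal{N}(0,1)$. Under $\mathcal{H}_1$ a path $s$ is drawn with probability $P(s)$ and, given $s$, the $y_{m,n}$ are independent with law $\mathcal{N}(\beta,1)$ if $m=s_n$ and $\mathcal{N}(0,1)$ if $m\ne s_n$. Fix $\epsilon\in(0,1)$ and let $\delta_N$ be the optimal (Neyman-Pearson, likelihood-ratio threshold) detector based on $Y^N$, i.e. the one minimizing the probability $P_{\mathrm{miss}}$ of deciding $\mathcal{H}_0$ under $\mathcal{H}_1$ subject to the probability of deciding $\mathcal{H}_1$ under $\mathcal{H}_0$ being at most $\epsilon$. The error exponent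 is $\eta=-\lim_{N\to\infty}\frac1N\log P_{\mathrm{miss}}(\delta_N)$; the limit exists, does not depend on $\epsilon$, and equals the Kullback-Leibler divergence rate $-\lim_{N\to\infty}\frac1N\mathbb{E}_0\log\frac{P_1(Y^N)}{P_0(Y^N)}$, where $\mathbb{E}_0$ is expectation under $\mathcal{H}_0$ and $P_0,P_1$ are the densities of $Y^N$ under the two hypotheses. *)

(* Defs.v *)
From HB Require Import structures.
From mathcomp Require Import all_boot all_order all_algebra.
From mathcomp Require Import all_classical all_reals all_analysis.

Set Implicit Arguments.
Unset Strict Implicit.
Unset Printing Implicit Defensive.

Import Order.TTheory GRing.Theory Num.Theory.
Import numFieldNormedType.Exports.

Local Open Scope classical_set_scope.
Local Open Scope ring_scope.

(** Finite Markov chains; the state set {1, ..., M} is ['I_M]. *)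

Section markov_chain.
Context {R : realType} {M : nat}.
Implicit Types (P : 'M[R]_M) (pi : 'rV[R]_M).

Definition stochastic P : Prop :=
  (forall i j, 0 <= P i j) /\ (forall i, \sum_j P i j = 1).

Definition irreducible P : Prop :=
  forall i j, exists k : nat, 0 < (P ^+ k) i j.

(* The gcd of the return times {k >= 1 | P^k i i > 0} is 1 for every state i;
   k = 0 may be included because every d divides 0. *)
Definition aperiodic P : Prop :=
  forall (i : 'I_M) (d : nat),
    (forall k : nat, 0 < (P ^+ k) i i -> (d %| k)%N) -> d = 1%N.

Definition stationary P pi : Prop :=
  [/\ forall i, 0 <= pi 0 i, \sum_i pi 0 i = 1 & pi *m P = pi].

(* pi_{s_1} p_{s_1,s_2} ... p_{s_{N-1},s_N}; the empty path has weight 1. *)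
Definition path_prob P pi (N : nat) (s : N.-tuple 'I_M) : R :=
  if tval s is i :: t then
    pi 0 i * \prod_(e <- zip (i :: t) t) P e.1 e.2
  else 1.

End markov_chain.

Section random_variables.
Context {R : realType} {d : measure_display} {T : measurableType d}.
Variable Q : probability T R.

(* Product rule over every finite subfamily. *)
Definition mutually_independent (I : finType) (X : I -> {RV Q >-> R}) : Prop :=
  forall (J : {set I}) (B : I -> set R), (forall i, measurable (B i)) ->
    Q (\bigcap_(i in [set` J]) (X i @^-1` B i)) =
    (\prod_(i in J) Q (X i @^-1` B i))%E.

(* N(m, sigma^2), to be used with sigma != 0: [normal_prob m 0] is not a
   point mass but a default value. *)
Definition normally_distributed (X : {RV Q >-> R}) (m sigma : R) : Prop :=
  forall B : set R, measurable B ->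
    distribution Q X B = normal_prob m sigma B.

End random_variables.

(** The observation space: [y : data R M N] has entry
    y_{m,n} = [tnth (tnth y n) m], i.e. it is stored column by column, and
    carries the product sigma-algebra of R^{M x N}. *)

Definition data (R : realType) (M N : nat) := N.-tuple (M.-tuple R).

Section hypotheses.
Context {R : realType} {M N : nat}.

Definition entry (m : 'I_M) (n : 'I_N) (y : data R M N) : R :=
  tnth (tnth y n) m.

Lemma measurable_entry m n : measurable_fun [set: data R M N] (entry m n).
Proof.
exact: (measurableT_comp (measurable_tnth (T := R) m)
                         (measurable_tnth (T := M.-tuple R) n)).
Qed.

HB.instance Definition _ m n :=
  isMeasurableFun.Build _ _ _ _ (entry m n) (measurable_entry m n).

(* The y_{m,n} are independent with laws N(mean m n, 1). *)
Definition gaussian_data (Q : probability (data R M N) R)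
    (mean : 'I_M -> 'I_N -> R) : Prop :=
  mutually_independent
    (fun mn : 'I_M * 'I_N => entry mn.1 mn.2 : {RV Q >-> R}) /\
  (forall m n, normally_distributed (entry m n : {RV Q >-> R}) (mean m n) 1).

Definition H0_law (P0 : probability (data R M N) R) : Prop :=
  gaussian_data P0 (fun _ _ => 0).

(* The law of the data when a path is drawn with probabilities [w]:
   [Q s] is the conditional law of the data given the path [s]. *)
Definition H1_law (w : N.-tuple 'I_M -> R) (beta : R)
    (P1 : probability (data R M N) R) : Prop :=
  exists Q : N.-tuple 'I_M -> probability (data R M N) R,
    (forall s, gaussian_data (Q s)
       (fun m n => if m == tnth s n then beta else 0)) /\
    (forall A : set (data R M N), measurable A ->
       P1 A = (\sum_(s : N.-tuple 'I_M) (w s)%:E * Q s A)%E).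

(* A detector is the measurable set of data on which H1 is decided. *)
Definition false_alarm (P0 : probability (data R M N) R)
  (A : set (data R M N)) : R := fine (P0 A).

Definition miss (P1 : probability (data R M N) R)
  (A : set (data R M N)) : R := fine (P1 (~` A)).

Definition optimal_detector (eps : R) (P0 P1 : probability (data R M N) R)
    (A : set (data R M N)) : Prop :=
  [/\ measurable A, false_alarm P0 A <= eps &
      forall B : set (data R M N), measurable B ->
        false_alarm P0 B <= eps -> miss P1 A <= miss P1 B].

End hypotheses.

(* Main.v *)
Require Import Defs.
From HB Require Import structures.
From mathcomp Require Import all_boot all_order all_algebra.
From mathcomp Require Import all_classical all_reals all_analysis.
From mathcomp Require Import measurable_realfun.
From mathcomp Require Import ring lra.

Set Implicit Arguments.
Unset Strict Implicit.
Unset Printing Implicit Defensive.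

Import Order.TTheory GRing.Theory Num.Theory.
Import numFieldNormedType.Exports.

Local Open Scope classical_set_scope.
Local Open Scope ring_scope.

(** The likelihood ratio is [exp (F - N beta^2/2)] with
    [F y = ln (sum_s P(s) exp (beta * sum_n y_{s_n,n}))].  Deciding H1 when
    [F > E_0 F + N c] has vanishing false alarm probability: [F] is
    [beta]-Lipschitz in each of its [M N] independent coordinates, so its
    variance is [O(N)] by the Efron-Stein argument.  A change of measure bounds
    the miss probability of this test by [exp (E_0 F + N c - N beta^2/2)].

    It remains to see that decorrelating the path sums increases [E F].  No
    Gaussian interpolation is needed: replace, for one pair [(s, n)] at a time,
    [y_{s_n,n}] by a fresh copy [z_{s,n}] in the exponent of the path [s] alone.
    For i.i.d. [u], [v], concavity of [ln] gives
    [E ln (r + A e^{bu} + B e^{bv}) >= E ln (r + (A + B) e^{bu})],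
    since the argument on the left is a convex combination of
    [r + (A + B) e^{bu}] and [r + (A + B) e^{bv}].  After all replacements the
    exponents [sum_n z_{s,n}] are independent with law [N(0, N)]. *)

(** * Finite product spaces and their product sigma-algebra *)

Section product_space.
Context {R : realType} {I : finType}.

Definition coord_preimages : set (set (I -> R)) :=
  [set A | exists i (B : set R), measurable B /\ A = (fun x => x i) @^-1` B].

(** Functions on an arbitrary finite type rather than tuples: the argument needs index sets such as
    pairs (m, n), paths, and disjoint sums of these. *)
Definition prodR := g_sigma_algebraType coord_preimages.

Definition box (B : I -> set R) : set prodR := [set x | forall i, B i (x i)].

Lemma measurable_coord i : measurable_fun [set: prodR] (fun x : prodR => x i).
Proof.
move=> _ B mB; rewrite setTI; apply: sub_sigma_algebra.
by exists i, B.
Qed.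

Lemma measurable_into_prodR d (T : measurableType d) (f : T -> prodR) :
  (forall i, measurable_fun setT (fun t => f t i)) -> measurable_fun setT f.
Proof.
move=> mf; apply: (@measurability _ _ T prodR setT f coord_preimages) => // _ [_ [i [B [mB ->]]] <-].
exact: mf.
Qed.

Lemma measurable_box B : (forall i, measurable (B i)) -> measurable (box B).
Proof.
move=> mB; rewrite (_ : box B = \bigcap_(i in [set: I]) ((fun x => x i) @^-1` B i)).
  apply: fin_bigcap_measurable => // i _; rewrite -[X in measurable X]setTI.
  exact: measurable_coord.
by apply/seteqP; split => x /= Bx; [move=> i _|move=> i]; exact: Bx.
Qed.

(** Boxes are stable under intersection and generate the sigma-algebra, so they determine a finite
    measure. *)
Lemma prodR_measure_unique (m1 m2 : {measure set prodR -> \bar R}) :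
  (m1 setT < +oo)%E ->
  (forall B, (forall i, measurable (B i)) -> m1 (box B) = m2 (box B)) ->
  forall A, measurable A -> m1 A = m2 A.
Proof.
move=> m1oo m12 A mA.
pose G : set (set prodR) :=
  [set A | exists2 B, (forall i, measurable (B i)) & A = box B].
have boxT : box (fun=> setT) = setT by apply/seteqP.
apply: (@measure_unique _ _ _ G (fun=> setT)) => //.
- apply/seteqP; split; apply: smallest_sub.
  + exact: smallest_sigma_algebra.
  + move=> _ [i [B [mB ->]]]; apply: sub_sigma_algebra.
    exists (fun j => if j == i then B else setT).
      by move=> j; case: ifP.
    apply/seteqP; split => x /= => [Bx j|/(_ i)]; last by rewrite eqxx.
    by case: eqP => // ->.
  + exact: sigma_algebra_measurable.
  + by move=> _ [B mB ->]; exact: measurable_box.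
- move=> _ _ [B mB ->] [C mC ->]; exists (fun i => B i `&` C i).
    by move=> i; exact: measurableI.
  apply/seteqP; split => x /= => [[Bx Cx] i|BCx]; first by split.
  by split => i; case: (BCx i).
- by move=> _; exists (fun=> setT).
- apply/seteqP; split => // x _; by exists 0%N.
- by move=> _ [B mB ->]; exact: m12.
Qed.

End product_space.
Arguments prodR R I : clear implicits.

(** * Product laws and the redrawing of single coordinates *)

Section product_law.
Context {R : realType} {I : finType}.
Implicit Types (nu : I -> probability R R) (m : probability (prodR R I) R).

Definition upd (x : prodR R I) (a : I) (u : R) : prodR R I :=
  fun i => if i == a then u else x i.

(** A predicate rather than a constructed measure, so that it also applies to laws of given random
    variables; by [prod_law_unique] it determines [m]. *)
Definition prod_law nu m : Prop := forall B : I -> set R,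
  (forall i, measurable (B i)) -> m (box B) = (\prod_i nu i (B i))%E.

Definition updp (a : I) (xu : prodR R I * R) : prodR R I := upd xu.1 a xu.2.

Lemma measurable_upd a :
  measurable_fun setT (updp a).
Proof.
apply: measurable_into_prodR => i; rewrite /updp /upd.
have [_|_] := eqVneq i a; first exact: measurable_snd.
exact: (measurableT_comp (measurable_coord i) measurable_fst).
Qed.

Lemma measurable_upd1 x a : measurable_fun setT (upd x a).
Proof.
apply: measurable_into_prodR => i; rewrite /upd.
by have [_|_] := eqVneq i a; [exact: measurable_id|exact: measurable_cst].
Qed.

HB.instance Definition _ a := isMeasurableFun.Build _ _ _ _
  (updp a) (measurable_upd a).

(* The law of [x] after its coordinate [a] is redrawn independently from [p]. *)
Definition resample m (p : probability R R) a : probability (prodR R I) R :=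
  distribution (m \x p)%E
    (updp a : {RV (m \x p)%E >-> prodR R I}).

Lemma prod_law_resample nu m (p : probability R R) a : prod_law nu m ->
  prod_law (fun i => if i == a then p else nu i) (resample m p a).
Proof.
move=> mP B mB; rewrite /resample/= /distribution /pushforward.
(* The old value at [a] is overwritten, hence unconstrained, and the preimage of the box is a
   rectangle. *)
pose B' i := if i == a then setT else B i.
have mB' i : measurable (B' i) by rewrite /B'; case: ifP.
rewrite (_ : _ @^-1` _ = box B' `*` B a); last first.
  apply/seteqP; split => -[x u] /=; rewrite /box /updp /upd /B' /=.
    move=> Bx; split => [i|]; last by have := Bx a; rewrite eqxx.
    by have := Bx i; case: eqP.
  by move=> -[Bx Bu] i; have := Bx i; case: eqP => //= ->.
rewrite product_measure1E//=; last exact: measurable_box.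
rewrite mP// [in RHS](bigD1 a)//= eqxx muleC (bigD1 a)//= [B' a]/B' eqxx.
rewrite probability_setT mul1e; apply: congr1.
by apply: eq_bigr => i; rewrite /B' => /negbTE ->.
Qed.

Lemma prod_law_unique nu m1 m2 : prod_law nu m1 -> prod_law nu m2 ->
  forall A, measurable A -> m1 A = m2 A.
Proof.
move=> m1P m2P; apply: prodR_measure_unique.
  by rewrite /= probability_setT ltry.
by move=> B mB /=; rewrite m1P// m2P.
Qed.

(** Redrawing a coordinate from its own law changes no box probability. This replaces a general
    Fubini theorem on [prodR]: coordinates are integrated out one at a time, without splitting the
    index type. *)
Lemma prod_law_resampleE nu m a : prod_law nu m ->
  forall A, measurable A -> m A = resample m (nu a) a A.
Proof.
move=> mP; apply: (prod_law_unique mP).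
have := prod_law_resample (nu a) a mP.
by congr prod_law; apply/funext => i; case: eqP => // ->.
Qed.

Lemma prod_law_ge0_integral nu m a (F : prodR R I -> \bar R) :
  prod_law nu m -> measurable_fun setT F -> (forall x, 0 <= F x)%E ->
  (\int[m]_x F x = \int[m]_x \int[nu a]_u F (upd x a u))%E.
Proof.
move=> mP mF F0.
rewrite (eq_measure_integral (resample m (nu a) a)); last first.
  by move=> A mA _; exact: prod_law_resampleE.
rewrite ge0_integral_distribution// fubini_tonelli1//=.
exact: measurableT_comp.
Qed.

Lemma measurable_resample_ge0 (p : probability R R) a (F : prodR R I -> \bar R) :
  measurable_fun setT F -> (forall x, 0 <= F x)%E ->
  measurable_fun setT (fun x => \int[p]_u F (upd x a u))%E.
Proof.
move=> mF F0.
apply: (@measurable_fun_fubini_tonelli_F _ _ _ _ _ p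
  (F \o updp a)); first exact: measurableT_comp.
by move=> xu; exact: F0.
Qed.

(** Starting from the Dirac mass at the origin, the coordinates are redrawn one after another from
    their laws. *)
Lemma prod_law_exists nu : exists m, prod_law nu m.
Proof.
suff /(_ (enum I)) [m mP] : forall l : seq I, exists m,
    prod_law (fun i => if i \in l then nu i else \d_(0 : R)) m.
  exists m => B mB; rewrite mP//.
  by apply: eq_bigr => i _; rewrite mem_enum.
elim=> [|a l [m mP]].
  exists (\d_((fun=> 0) : prodR R I)) => B mB.
  rewrite /= diracE; have [B0|] := boolP (_ \in box B).
    rewrite big1// => i _; rewrite diracE mem_set//.
    by move: B0; rewrite inE => /(_ i).
  rewrite notin_setE => /existsNP[i Bi]; rewrite (bigD1 i)//= diracE.
  by rewrite memNset// mul0e.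
exists (resample m (nu a) a); have := prod_law_resample (nu a) a mP.
congr prod_law; apply/funext => i; rewrite inE.
by case: eqP => // ->.
Qed.

Lemma measurable_prod_coord (l : seq I) (f : I -> R -> \bar R) :
  (forall i, measurable_fun setT (f i)) ->
  measurable_fun [set: prodR R I] (fun x : prodR R I => \prod_(i <- l) f i (x i))%E.
Proof.
move=> mf; elim: l => [|a l IH].
  by apply: eq_measurable_fun (measurable_cst 1%E) => x _; rewrite big_nil.
apply: (@eq_measurable_fun _ _ _ _ setT
  (fun x : prodR R I => f a (x a) * \prod_(i <- l) f i (x i))%E).
  by move=> x _; rewrite big_cons.
apply: emeasurable_funM => //.
exact: measurableT_comp (mf a) (measurable_coord a).
Qed.

(** The head coordinate is integrated first; as [l] has no repetition, the other factors do not see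
    it and leave the inner integral. *)
Lemma prod_law_prod nu m (l : seq I) (f : I -> R -> \bar R) : prod_law nu m ->
  (forall i, measurable_fun setT (f i)) -> (forall i u, 0 <= f i u)%E -> uniq l ->
  (\int[m]_x \prod_(i <- l) f i (x i) = \prod_(i <- l) \int[nu i]_u f i u)%E.
Proof.
move=> mP mf f0; have pf0 (l' : seq I) x : (0 <= \prod_(i <- l') f i (x i))%E.
  by apply: prode_ge0 => i _; exact: f0.
elim: l => [_|a l IH /=/andP[al ul]].
  rewrite big_nil; under eq_integral do rewrite big_nil.
  by rewrite integral_cst// mul1e; exact: probability_setT.
rewrite (prod_law_ge0_integral a mP) //; last exact: measurable_prod_coord.
rewrite big_cons -(IH ul) -ge0_integralZl//.
- apply: eq_integral => x _.
  rewrite -ge0_integralZr//.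
  apply: eq_integral => u _; rewrite big_cons /upd eqxx; congr (_ * _)%E.
  apply: eq_big_seq => i il; case: eqP => // ia.
  by rewrite ia (negbTE al) in il.
- exact: measurable_prod_coord.
- by apply: integral_ge0 => u _; exact: f0.
Qed.

End product_law.

(** * Exponential moments and functions of exponential growth *)

Section exponential_growth.
Context {R : realType}.

Definition exp_moments (p : probability R R) : Prop :=
  forall k : R, (\int[p]_u (expR (k * `|u|))%:E < +oo)%E.

Lemma exp_dominated_integrable (p : probability R R) (g : R -> R) C k :
  exp_moments p -> measurable_fun setT g ->
  (forall u, `|g u| <= C * expR (k * `|u|)) ->
  p.-integrable setT (EFin \o g).
Proof.
move=> pexp mg gC.
have mk : measurable_fun setT (fun u : R => expR (k * `|u|)).
  apply: measurableT_comp; first exact: measurable_expR.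
  by apply: measurable_funM => //; exact: measurable_normr.
apply: (@le_integrable _ _ _ p _ measurableT _
  (fun u => C%:E * (expR (k * `|u|))%:E)%E).
- exact/measurable_EFinP.
- move=> u _; rewrite -EFinM /= lee_fin (le_trans (gC u))//; exact: ler_norm.
- apply: integrableZl => //; apply/integrableP; split; first exact/measurable_EFinP.
  under eq_integral do rewrite gee0_abs ?lee_fin ?expR_ge0//.
  exact: pexp.
Qed.

Context {I : finType}.
Implicit Types (nu : I -> probability R R) (m : probability (prodR R I) R)
  (x : prodR R I) (a : I) (F : prodR R I -> R).

(* A class stable under squares and partial integration on which every
   integral below is finite; mere integrability would leave partial integrals
   defined only almost everywhere. *)
Definition subexp (F : prodR R I -> R) : Prop :=
  measurable_fun setT F /\ exists C k, [/\ 0 <= C, 0 <= k &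
    forall x, `|F x| <= C * expR (k * \sum_i `|x i|)].

(** The conditional expectation given the coordinates other than [a], realised as a function on the
    whole space that is constant in coordinate [a]. *)
Definition condE nu a F x : R :=
  \int[nu a]_u F (upd x a u).

Lemma sum_norm_upd x a u :
  \sum_i `|upd x a u i| = `|u| + \sum_(i | i != a) `|x i|.
Proof.
rewrite (bigD1 a)//= /upd eqxx; congr (_ + _).
by apply: eq_bigr => i /negbTE ->.
Qed.

Lemma subexp_upd F x a : subexp F -> exists C k, [/\ 0 <= C, 0 <= k &
  forall u, `|F (upd x a u)| <= C * expR (k * `|u|)].
Proof.
case=> _ [C [k [C0 k0 FC]]].
exists (C * expR (k * \sum_(i | i != a) `|x i|)), k; split => //.
  by rewrite mulr_ge0// expR_ge0.
move=> u; apply: le_trans (FC _) _.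
by rewrite sum_norm_upd mulrDr expRD mulrCA mulrC.
Qed.

Lemma subexp_sqr F : subexp F -> subexp (fun x => F x ^+ 2).
Proof.
case=> mF [C [k [C0 k0 FC]]]; split; first exact: measurable_funX.
exists (C ^+ 2), (k *+ 2); rewrite sqr_ge0 mulrn_wge0//; split => // x.
rewrite normrX mulrnAl mulr2n expRD mulrACA -expr2.
by rewrite ler_pXn2r// ?nnegrE// mulr_ge0// expR_ge0.
Qed.

Section law.
Variables (nu : I -> probability R R).
Hypothesis nu_exp : forall i, exp_moments (nu i).

Lemma subexp_upd_integrable F x a : subexp F ->
  (nu a).-integrable setT (fun u => (F (upd x a u))%:E).
Proof.
move=> Fs; have [C [k [_ _ FC]]] := subexp_upd x a Fs.
apply: (@exp_dominated_integrable _ (fun u => F (upd x a u)) C k) => //.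
by apply: measurableT_comp (measurable_upd1 x a); case: Fs.
Qed.

(** The dominating exponential of a sum is a product over the coordinates, and each factor has a
    finite integral by [nu_exp]. *)
Lemma subexp_integrable m F : prod_law nu m -> subexp F ->
  m.-integrable setT (EFin \o F).
Proof.
move=> mP [mF [C [k [C0 k0 FC]]]].
pose f (i : I) (u : R) : \bar R := (expR (k * `|u|))%:E.
have mf i : measurable_fun setT (f i).
  apply/measurable_EFinP; apply: measurableT_comp; first exact: measurable_expR.
  by apply: measurable_funM => //; exact: measurable_normr.
have fE x : (\prod_i f i (x i))%E = (expR (k * \sum_i `|x i|))%:E.
  by rewrite mulr_sumr expR_sum -prodEFin.
apply: (@le_integrable _ _ _ m _ measurableT _
  (fun x => C%:E * \prod_i f i (x i))%E).
- exact/measurable_EFinP.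
- move=> x _; rewrite fE -EFinM /= lee_fin (le_trans (FC x))//; exact: ler_norm.
- apply: integrableZl => //; apply/integrableP; split.
    exact: measurable_prod_coord.
  under eq_integral.
    move=> x _; rewrite fE gee0_abs ?lee_fin ?expR_ge0// -fE; over.
  rewrite (prod_law_prod mP) ?index_enum_uniq//.
    have f_fin i : (\int[nu i]_u f i u)%E \is a fin_num.
      by rewrite ge0_fin_numE ?nu_exp// integral_ge0// => u _; rewrite lee_fin expR_ge0.
    rewrite -ge0_fin_numE; last first.
      by apply: prode_ge0 => i _; apply: integral_ge0 => u _; rewrite lee_fin expR_ge0.
    by apply: prode_fin_num => i _; exact: f_fin.
  by move=> i u; rewrite lee_fin expR_ge0.
Qed.

Lemma subexp_condE a F : subexp F -> subexp (condE nu a F).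
Proof.
move=> Fs; case: (Fs) => mF [C [k [C0 k0 FC]]]; split.
  apply: (@measurableT_comp _ _ _ _ _ _ fine) => //.
  (* Positive and negative parts are integrated separately, since Tonelli makes each partial
     integral measurable. *)
  apply: (@eq_measurable_fun _ _ _ _ setT
    (fun x => \int[nu a]_u (EFin \o F)^\+ (upd x a u)
            - \int[nu a]_u (EFin \o F)^\- (upd x a u))%E).
    by move=> x _; rewrite [RHS]integralE; congr (_ - _)%E;
      apply: eq_integral => u _; rewrite !(funeposE, funenegE).
  apply: emeasurable_funB; apply: measurable_resample_ge0 => //.
  - by apply: measurable_funepos; exact/measurable_EFinP.
  - by apply: measurable_funeneg; exact/measurable_EFinP.
have i_exp : (nu a).-integrable setT (EFin \o (fun u : R => expR (k * `|u|))).
  apply: (@exp_dominated_integrable _ _ 1 k) => //.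
    apply: measurableT_comp; first exact: measurable_expR.
    by apply: measurable_funM => //; exact: measurable_normr.
  by move=> u; rewrite mul1r ger0_norm// expR_ge0.
pose c := \int[nu a]_u expR (k * `|u|).
have c0 : 0 <= c by apply: Rintegral_ge0 => u _; exact: expR_ge0.
(* The rate [k] survives; integrating the factor in [u] multiplies the constant by [c]. *)
exists (C * c), k; split => //; first exact: mulr_ge0.
move=> x; rewrite /condE.
have iF := subexp_upd_integrable x a Fs.
apply: le_trans (le_normr_Rintegral measurableT iF) _.
apply: (@le_trans _ _ (\int[nu a]_u
    (C * expR (k * \sum_i `|x i|) * expR (k * `|u|)))).
  apply: le_Rintegral => //.
  - exact: integrable_norm.
  - exact: (integrableZl _ _ i_exp).
  - move=> u _; apply: le_trans (FC _) _.
    rewrite sum_norm_upd -mulrA ler_wpM2l// -expRD ler_expR -mulrDr ler_wpM2l//.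
    rewrite addrC lerD2r [leRHS](bigD1 a)//= lerDr; exact: normr_ge0.
rewrite RintegralZl//=.
by rewrite mulrAC.
Qed.

(** The tower property: [m] is replaced by its resampled version, a pushforward of the product of
    [m] and [nu a], to which Fubini applies. *)
Lemma Rintegral_condE m a F : prod_law nu m -> subexp F ->
  \int[m]_x F x = \int[m]_x condE nu a F x.
Proof.
move=> mP Fs; case: (Fs) => mF _.
pose m' := resample m (nu a) a.
have m'P : prod_law nu m'.
  have := prod_law_resample (nu a) a mP.
  by congr prod_law; apply/funext => i; case: eqP => // ->.
have mFE : measurable_fun setT (EFin \o F) by exact/measurable_EFinP.
have iFu : (m \x nu a)%E.-integrable setT ((EFin \o F) \o updp a).
  apply/integrableP; split; first exact: measurableT_comp.
  have /integrableP[_] := subexp_integrable m'P Fs.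
  by rewrite ge0_integral_distribution//; exact: measurableT_comp.
rewrite /Rintegral (eq_measure_integral m'); last first.
  by move=> A mA _; exact: prod_law_resampleE.
rewrite integral_distribution// -integral12_prod_meas1//.
congr fine; apply: eq_integral => x _ /=; rewrite /condE /Rintegral fineK//.
exact: (integrable_fin_num measurableT (subexp_upd_integrable x a Fs)).
Qed.

End law.
End exponential_growth.

(** * Efron-Stein type variance bound for coordinatewise Lipschitz functions *)

Section variance_bound.
Context {R : realType}.

(** Squaring |u|/2 <= exp (|u|/2) produces the constant 4. *)
Lemma sqr_le_expR (u : R) : u ^+ 2 <= 4 * expR `|u|.
Proof.
have h : 0 <= `|u| / 2 by rewrite divr_ge0.
have le1 : `|u| / 2 <= expR (`|u| / 2).
  by apply: le_trans (expR_ge1Dx _); rewrite lerDr.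
have -> : `|u| = `|u| / 2 + `|u| / 2 by lra.
rewrite expRD -real_normK ?num_real//.
nra.
Qed.

Lemma measurable_sqr_fun (g : R -> R) :
  measurable_fun setT g -> measurable_fun setT (fun u => g u ^+ 2).
Proof. by move=> mg; exact: measurable_funX. Qed.

(** The Lipschitz bound controls the second moment of [g] about [g 0], and the variance is the
    smallest second moment about a constant. Centring at [g 0] avoids a second independent copy of
    [u]. *)
Lemma variance_lipschitz (p : probability R R) (g : R -> R) L :
  exp_moments p -> 0 <= L -> measurable_fun setT g ->
  (forall u, `|g u - g 0| <= L * `|u|) ->
  \int[p]_u (g u ^+ 2) <= (\int[p]_u g u) ^+ 2 + L ^+ 2 * \int[p]_u (u ^+ 2).
Proof.
move=> pexp L0 mg gL.
have id_le (u : R) : `|u| <= expR (1 * `|u|).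
  by rewrite mul1r; apply: le_trans (expR_ge1Dx _); rewrite lerDr.
have ig : p.-integrable setT (EFin \o g).
  apply: (exp_dominated_integrable (C := `|g 0| + L) (k := 1)) => // u.
  have := gL u; have := ler_normD (g u - g 0) (g 0); rewrite subrK => h1 h2.
  apply: le_trans h1 _; have := id_le u; have := @expR_ge1Dx _ (1 * `|u|).
  have := normr_ge0 u; have := normr_ge0 (g 0); nra.
have ig2 : p.-integrable setT (EFin \o (fun u => g u ^+ 2)).
  apply: (exp_dominated_integrable (C := (`|g 0| + L) ^+ 2) (k := 2)) => //.
    exact: measurable_sqr_fun.
  move=> u; rewrite normrX.
  have -> : 2 * `|u| = 1 * `|u| + 1 * `|u| by lra.
  rewrite expRD -expr2 -exprMn ler_pXn2r// ?nnegrE//; last first.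
    by rewrite mulr_ge0 ?expR_ge0// addr_ge0.
  have := gL u; have := ler_normD (g u - g 0) (g 0); rewrite subrK => h1 h2.
  apply: le_trans h1 _; have := id_le u; have := @expR_ge1Dx _ (1 * `|u|).
  have := normr_ge0 u; have := normr_ge0 (g 0); nra.
have iu2 : p.-integrable setT (EFin \o (fun u : R => u ^+ 2)).
  apply: (exp_dominated_integrable (C := 4) (k := 1)) => //.
  by move=> u; rewrite ger0_norm ?sqr_ge0// mul1r sqr_le_expR.
have i1 : p.-integrable setT (EFin \o (fun u => 2 * g 0 * g u)).
  exact: (integrableZl measurableT (2 * g 0) ig).
have i2 : p.-integrable setT (EFin \o (fun u => g u ^+ 2 - 2 * g 0 * g u)).
  exact: (integrableB measurableT ig2 i1).
have i3 : p.-integrable setT (EFin \o cst (g 0 ^+ 2)).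
  exact: finite_measure_integrable_cst.
have le2 : \int[p]_u (g u ^+ 2 - 2 * g 0 * g u + g 0 ^+ 2)
           <= \int[p]_u (L ^+ 2 * u ^+ 2).
  apply: le_Rintegral => //.
  - exact: (integrableD measurableT i2 i3).
  - exact: (integrableZl measurableT _ iu2).
  - move=> u _; have := gL u; rewrite -(@ler_pXn2r _ 2)// ?nnegrE ?mulr_ge0//.
    rewrite exprMn !real_normK ?num_real// => h; apply: le_trans h; nra.
rewrite RintegralD// in le2.
rewrite RintegralB// in le2.
rewrite Rintegral_cst// !RintegralZl// in le2.
have p1 : fine (p setT) = 1 by rewrite probability_setT.
rewrite p1 in le2.
set G := \int[p]_u g u in le2 *; set G2 := \int[p]_u (g u ^+ 2) in le2 *.
(* This square passes from the centre [g 0] to the mean [G]. *)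
have := sqr_ge0 (G - g 0); nra.
Qed.

Context {I : finType}.
Implicit Types (nu : I -> probability R R) (m : probability (prodR R I) R)
  (x : prodR R I) (a : I) (F : prodR R I -> R).

Definition coord_lipschitz L F : Prop :=
  forall x a u v, `|F (upd x a u) - F (upd x a v)| <= L * `|u - v|.

Lemma upd_upd x a u v : upd (upd x a u) a v = upd x a v.
Proof. by apply/funext => i; rewrite /upd; case: eqP. Qed.

Lemma updC x a b u v : a != b ->
  upd (upd x a u) b v = upd (upd x b v) a u.
Proof.
move=> ab; apply/funext => i; rewrite /upd.
by have [->|] := eqVneq i a; rewrite // (negbTE ab).
Qed.

Section law.
Variables (nu : I -> probability R R).
Hypothesis nu_exp : forall i, exp_moments (nu i).

(** In direction [a] the average is constant; in any other direction the update commutes with that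
    of [a], and the bound passes under the integral. *)
Lemma coord_lipschitz_condE L a F : 0 <= L -> subexp F ->
  coord_lipschitz L F -> coord_lipschitz L (condE nu a F).
Proof.
move=> L0 Fs FL x b u v; rewrite /condE.
have iF y := subexp_upd_integrable nu_exp y a Fs.
have [ab|ab] := eqVneq a b.
  rewrite ab; under eq_Rintegral do rewrite upd_upd.
  under [X in _ - X]eq_Rintegral do rewrite upd_upd.
  by rewrite subrr normr0 mulr_ge0.
rewrite -RintegralB//; last 2 first.
- exact: iF.
- exact: iF.
have iD : (nu a).-integrable setT (EFin \o
    (fun t => F (upd (upd x b u) a t) - F (upd (upd x b v) a t))).
  exact: (integrableB measurableT (iF _) (iF _)).
apply: le_trans (le_normr_Rintegral measurableT iD) _.
apply: (@le_trans _ _ (\int[nu a]_t (L * `|u - v|))).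
  apply: le_Rintegral => //.
  - exact: integrable_norm.
  - exact: finite_measure_integrable_cst.
  - by move=> t _; rewrite ![upd (upd x b _) a t]updC 1?eq_sym// FL.
rewrite Rintegral_cst// (_ : fine _ = 1) ?mulr1//.
by rewrite [X in fine X]probability_setT.
Qed.

Lemma condE_sqr_le L a F x : 0 <= L -> subexp F -> coord_lipschitz L F ->
  condE nu a (fun x => F x ^+ 2) x
    <= (condE nu a F x) ^+ 2 + L ^+ 2 * \int[nu a]_u (u ^+ 2).
Proof.
move=> L0 [mF _] FL; apply: variance_lipschitz => //.
- by apply: measurableT_comp (measurable_upd1 x a).
- by move=> u; apply: le_trans (FL _ _ _ _) _; rewrite subr0.
Qed.

Definition condEs (l : seq I) F := foldr (condE nu) F l.

(** Coordinates averaged out no longer matter. With the list of all coordinates, [condEs] is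
    therefore constant. *)
Lemma condEs_eq l F x y : (forall i, i \notin l -> x i = y i) ->
  condEs l F x = condEs l F y.
Proof.
elim: l x y => [|a l IH] x y xy /=; first by congr F; apply/funext => i; exact: xy.
apply: eq_Rintegral => u _; apply: IH => i il; rewrite /upd.
by case: eqP => // /eqP ia; apply: xy; rewrite inE negb_or ia.
Qed.

Lemma subexp_condEs l F : subexp F -> subexp (condEs l F).
Proof. by move=> Fs; elim: l => //= a l; exact: subexp_condE. Qed.

Lemma coord_lipschitz_condEs L l F : 0 <= L -> subexp F -> coord_lipschitz L F ->
  coord_lipschitz L (condEs l F).
Proof.
move=> L0 Fs FL; elim: l => //= a l; apply: coord_lipschitz_condE => //.
exact: subexp_condEs.
Qed.

Lemma Rintegral_condEs m l F : prod_law nu m -> subexp F ->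
  \int[m]_x F x = \int[m]_x condEs l F x.
Proof.
move=> mP Fs; elim: l => //= a l ->; apply: Rintegral_condE => //.
exact: subexp_condEs.
Qed.

(** Coordinates are averaged out one at a time. Each costs at most [L ^+ 2 * c] by the
    one-dimensional bound, and at the end a constant remains, equal to the mean of [F]. *)
Lemma variance_le m F L c : prod_law nu m -> subexp F -> 0 <= L ->
  coord_lipschitz L F -> (forall a, \int[nu a]_u (u ^+ 2) <= c) ->
  \int[m]_x (F x ^+ 2) <= (\int[m]_x F x) ^+ 2 + L ^+ 2 * c *+ #|I|.
Proof.
move=> mP Fs L0 FL nuc.
have step l : \int[m]_x (F x ^+ 2)
    <= \int[m]_x (condEs l F x ^+ 2) + L ^+ 2 * c *+ size l.
  elim: l => [|a l IH]; first by rewrite mulr0n addr0.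
  apply: le_trans IH _; rewrite mulrS addrA lerD2r.
  have s2 := subexp_sqr (subexp_condEs l Fs).
  (* Averaging the square over [a] keeps its integral; [condE_sqr_le] then compares it with the
     square of the average. *)
  rewrite (Rintegral_condE nu_exp a mP s2).
  have is2 := subexp_integrable nu_exp mP (subexp_sqr (subexp_condEs (a :: l) Fs)).
  have icst : m.-integrable setT (EFin \o cst (L ^+ 2 * c)).
    exact: finite_measure_integrable_cst.
  have -> : \int[m]_x (condEs (a :: l) F x ^+ 2) + L ^+ 2 * c =
      \int[m]_x (condEs (a :: l) F x ^+ 2 + cst (L ^+ 2 * c) x).
    rewrite RintegralD// Rintegral_cst// (_ : fine _ = 1) ?mulr1//.
    by rewrite [X in fine X]probability_setT.
  apply: le_Rintegral => //.
  - exact: (subexp_integrable nu_exp mP (subexp_condE nu_exp a s2)).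
  - exact: (integrableD measurableT is2 icst).
  move=> x _; apply: le_trans (condE_sqr_le a x L0 _ _) _.
  - exact: subexp_condEs.
  - exact: coord_lipschitz_condEs.
  by rewrite lerD2l ler_wpM2l// sqr_ge0.
apply: le_trans (step (enum I)) _; rewrite -cardE lerD2r.
rewrite (Rintegral_condEs (enum I) mP Fs).
have cE x : condEs (enum I) F x = condEs (enum I) F (fun=> 0).
  by apply: condEs_eq => i; rewrite mem_enum.
under eq_Rintegral do rewrite cE.
under [X in _ <= X ^+ 2]eq_Rintegral do rewrite cE.
have m1 : fine (m setT) = 1 by rewrite [X in fine X]probability_setT.
by rewrite !Rintegral_cst// m1 !mulr1.
Qed.

End law.
End variance_bound.

(** * Integration against a measure with a density *)

Section density.
Context d (T : measurableType d) (R : realType).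
Variables (mu nu : {measure set T -> \bar R}) (p : T -> R).
Hypotheses (mp : measurable_fun setT p) (p0 : forall x, 0 <= p x).
Hypothesis nuE : forall A, measurable A -> nu A = (\int[mu]_(x in A) (p x)%:E)%E.

Let mpE : measurable_fun setT (EFin \o p). Proof. exact/measurable_EFinP. Qed.

Import HBNNSimple.

Let integral_density_indic A : measurable A ->
  (\int[nu]_x (\1_A x)%:E = \int[mu]_x ((\1_A x)%:E * (p x)%:E))%E.
Proof.
move=> mA; rewrite integral_indic// setIT nuE// [LHS]integral_mkcond.
apply: eq_integral => x _; rewrite patchE indicE.
by case: ifPn => _; rewrite ?mul1e ?mul0e.
Qed.

Let integral_density_nnsfun (f : {nnsfun T >-> R}) :
  (\int[nu]_x (f x)%:E = \int[mu]_x ((f x)%:E * (p x)%:E))%E.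
Proof.
under [LHS]eq_integral do rewrite fimfunE -fsumEFin//.
rewrite [LHS]ge0_integral_fsum//; last 2 first.
- by move=> r; exact/measurable_EFinP/measurableT_comp.
- by move=> r x _; rewrite EFinM nnfun_muleindic_ge0.
under [RHS]eq_integral.
  move=> x xD; rewrite fimfunE -fsumEFin// ge0_mule_fsuml; last first.
    by move=> r; rewrite EFinM nnfun_muleindic_ge0.
  over.
rewrite [RHS]ge0_integral_fsum//; last 2 first.
- move=> r; apply: emeasurable_funM => //.
  by apply/measurable_EFinP; exact: measurable_funM.
- move=> r x _; apply: mule_ge0; last by rewrite lee_fin.
  by rewrite EFinM nnfun_muleindic_ge0.
apply: eq_fsbigr => r; rewrite inE => -[x _ <-].
under eq_integral do rewrite EFinM.
under [RHS]eq_integral do rewrite EFinM -muleA.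
rewrite ge0_integralZl//; last 2 first.
- exact/measurable_EFinP.
- by rewrite lee_fin.
rewrite integral_density_indic// ge0_integralZl//.
- by apply: emeasurable_funM => //; exact/measurable_EFinP.
- by move=> y _; rewrite mule_ge0// lee_fin.
- by rewrite lee_fin.
Qed.

(** The usual extension: indicators, then nonnegative simple functions, then monotone limits. *)
Lemma ge0_integral_density (f : T -> \bar R) :
  measurable_fun setT f -> (forall x, 0 <= f x)%E ->
  (\int[nu]_x f x = \int[mu]_x (f x * (p x)%:E))%E.
Proof.
move=> mf f0.
pose f_ := nnsfun_approx measurableT mf.
transitivity (lim (\int[nu]_x (f_ n x)%:E @[n --> \oo])%E).
  rewrite -monotone_convergence//=.
  - apply: eq_integral => x _; apply/esym/cvg_lim => //=.
    exact: cvg_nnsfun_approx.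
  - by move=> n; exact/measurable_EFinP/measurable_funTS.
  - by move=> n ? _; rewrite lee_fin.
  - by move=> ? _ ? ? mn; rewrite lee_fin; exact/lefP/nd_nnsfun_approx.
transitivity (lim (\int[mu]_x ((f_ n x)%:E * (p x)%:E) @[n --> \oo])%E).
  by apply: congr_lim; apply/funext => n /=; exact: integral_density_nnsfun.
rewrite -monotone_convergence//=.
- apply: eq_integral => x _; apply/cvg_lim => //=.
  by apply: cvgeZr => //; exact: cvg_nnsfun_approx.
- by move=> n; apply: emeasurable_funM => //; exact/measurable_EFinP/measurable_funTS.
- by move=> n x _; rewrite mule_ge0// lee_fin.
- move=> x _ a b ab; rewrite lee_wpmul2r ?lee_fin//.
  exact/lefP/nd_nnsfun_approx.
Qed.

End density.

(** * Normal laws: exponential tilting and convolution *)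

Section normal.
Context {R : realType}.
Local Notation mu := (@lebesgue_measure R).

Let idTR : measurableTypeR R -> R := idfun.

#[local] HB.instance Definition _ :=
  @isMeasurableFun.Build _ _ _ _ idTR (@measurable_id _ _ setT).

(* [normal_prob] lives on [measurableTypeR R], whose display is not that of [R]. *)
Definition normal (m s : R) : probability R R :=
  distribution (normal_prob m s) (idTR : {RV (normal_prob m s) >-> R}).

Lemma normal_density (m s : R) (f : R -> \bar R) :
  measurable_fun setT f -> (forall x, 0 <= f x)%E ->
  (\int[normal m s]_x f x = \int[mu]_x (f x * (normal_pdf m s x)%:E))%E.
Proof.
move=> mf f0; rewrite ge0_integral_distribution//=.
apply: (@ge0_integral_density _ (measurableTypeR R)) => //.
- exact: measurable_normal_pdf.
- by move=> x; exact: normal_pdf_ge0.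
Qed.

Let shiftR (c : R) : measurableTypeR R -> measurableTypeR R := fun x => x + c.

Let measurable_shiftR c : measurable_fun setT (shiftR c).
Proof. by apply: measurable_funD => //; exact: measurable_cst. Qed.

#[local] HB.instance Definition _ c :=
  isMeasurableFun.Build _ _ _ _ (shiftR c) (measurable_shiftR c).

(** Translation invariance has to be checked only on half-open intervals, which determine Lebesgue
    measure. *)
Let lebesgue_measure_shift c (A : set (measurableTypeR R)) : measurable A ->
  mu A = pushforward mu (shiftR c) A.
Proof.
move: A; apply: lebesgue_measure_unique => _ [[a b]] _ <-.
change (mu `]a, b]%classic = mu (shiftR c @^-1` `]a, b]%classic)).
rewrite (_ : _ @^-1` _ = `]a - c, b - c]%classic); last first.
  by apply/seteqP; split => x /=; rewrite !in_itv/= ltrBlDr lerBrDr.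
rewrite !lebesgue_measure_itv/= !lte_fin ltrD2r; case: ifP => // _.
by rewrite -!EFinB; congr (_%:E); lra.
Qed.

Lemma lebesgue_shift (c : R) (f : R -> \bar R) :
  measurable_fun setT f -> (forall x, 0 <= f x)%E ->
  (\int[mu]_x f (x + c)%R = \int[mu]_x f x)%E.
Proof.
move=> mf f0.
have -> : (\int[mu]_x f x = \int[pushforward mu (shiftR c)]_x f x)%E.
  apply: eq_measure_integral => A mA _.
  exact: lebesgue_measure_shift.
by rewrite ge0_integral_pushforward.
Qed.

(** Completing the square. Tilting serves twice: for the exponential moments, and later for the
    likelihood ratio of normal laws with different means. *)
Lemma normal_fun_tilt (m s k x : R) : s != 0 ->
  expR (k * x) * normal_fun m s x =
  expR (k * m + k ^+ 2 * s ^+ 2 / 2) * normal_fun (m + k * s ^+ 2) s x.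
Proof.
move=> s0; rewrite /normal_fun -!expRD; congr expR.
have s2 : s ^+ 2 != 0 by rewrite expf_neq0.
by field.
Qed.

Lemma normal_pdf_tilt (m s k x : R) : s != 0 ->
  expR (k * x) * normal_pdf m s x =
  expR (k * m + k ^+ 2 * s ^+ 2 / 2) * normal_pdf (m + k * s ^+ 2) s x.
Proof.
by move=> s0; rewrite !normal_pdfE// mulrCA normal_fun_tilt// mulrCA.
Qed.

(** The exponential of k|x| is at most the sum of those of kx and -kx, whose integrals tilting
    computes. *)
Lemma normal_exp_moments (m s : R) : s != 0 -> exp_moments (normal m s).
Proof.
move=> s0 k.
have mexp c : measurable_fun setT (fun x : R => (expR (c * x))%:E).
  apply/measurable_EFinP; apply: measurableT_comp; first exact: measurable_expR.
  exact: measurable_funM.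
have moment c : (\int[normal m s]_x (expR (c * x))%:E =
    (expR (c * m + c ^+ 2 * s ^+ 2 / 2))%:E)%E.
  rewrite normal_density//.
  under eq_integral do rewrite -EFinM normal_pdf_tilt// EFinM.
  rewrite ge0_integralZl//; last 2 first.
  - by apply/measurable_EFinP; exact: measurable_normal_pdf.
  - by move=> x _; rewrite lee_fin normal_pdf_ge0.
  by rewrite integral_normal_pdf mule1.
apply: (@le_lt_trans _ _ (\int[normal m s]_x
    ((expR (k * x))%:E + (expR (- k * x))%:E))%E).
  apply: ge0_le_integral => //.
  - apply/measurable_EFinP; apply: measurableT_comp; first exact: measurable_expR.
    by apply: measurable_funM => //; exact: measurable_normr.
  - exact: emeasurable_funD.
  - move=> x _; rewrite -EFinD lee_fin.
    case: (ler0P x) => _; first by rewrite mulrN mulNr lerDr expR_ge0.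
    by rewrite lerDl expR_ge0.
rewrite ge0_integralD//; [|by move=> x _; rewrite lee_fin expR_ge0..].
by rewrite !moment -EFinD ltry.
Qed.

(** Let [v] be [u] plus independent standard noise. Their joint density is factored as the marginal
    of [v] times the conditional density of [u] given [v]; the latter integrates to one. *)
Lemma normal_pdf_convolution (s u v : R) : s != 0 ->
  normal_pdf 0 1 (v - u) * normal_pdf 0 s u =
  normal_pdf 0 (Num.sqrt (s ^+ 2 + 1)) v *
  normal_pdf (v * s ^+ 2 / (s ^+ 2 + 1)) (s / Num.sqrt (s ^+ 2 + 1)) u.
Proof.
move=> s0; have s2 : 0 < s ^+ 2 by rewrite exprn_even_gt0.
have r2 : 0 < s ^+ 2 + 1 by rewrite ltr_wpDr.
have r0 : Num.sqrt (s ^+ 2 + 1) != 0 by rewrite gt_eqF// sqrtr_gt0.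
have rE : Num.sqrt (s ^+ 2 + 1) ^+ 2 = s ^+ 2 + 1 by rewrite sqr_sqrtr// ltW.
rewrite !normal_pdfE ?oner_eq0//; last by rewrite mulf_neq0// invr_neq0.
rewrite mulrACA [RHS]mulrACA; congr (_ * _).
  rewrite /normal_peak -!invfM -!sqrtrM; last first.
  - by rewrite -mulr_natl !mulr_ge0 ?sqr_ge0 ?pi_ge0.
  - by rewrite -mulr_natl !mulr_ge0 ?sqr_ge0 ?pi_ge0.
  congr (Num.sqrt _)^-1; rewrite expr_div_n rE; field.
  by rewrite gt_eqF.
rewrite /normal_fun -!expRD; congr expR.
rewrite expr_div_n rE; field.
by rewrite s0 gt_eqF.
Qed.

Lemma normal_convolution (s : R) (f : R -> \bar R) : s != 0 ->
  measurable_fun setT f -> (forall x, 0 <= f x)%E ->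
  (\int[normal 0 s]_t \int[normal 0 1]_u f (u + t)%R =
   \int[normal 0 (Num.sqrt (s ^+ 2 + 1))]_v f v)%E.
Proof.
move=> s0 mf f0.
have mpdf m r : measurable_fun setT (fun x : R => (normal_pdf m r x)%:E).
  by apply/measurable_EFinP; exact: measurable_normal_pdf.
have pdf0 m r x : (0 <= (normal_pdf m r x)%:E :> \bar R)%E.
  by rewrite lee_fin normal_pdf_ge0.
have mshift t : measurable_fun setT (fun u : R => f (u + t)).
  by apply: measurableT_comp => //; apply: measurable_funD => //; exact: measurable_cst.
have madd : measurable_fun setT (fun tu : R * R => f (tu.2 + tu.1)).
  apply: measurableT_comp => //.
  by apply: measurable_funD; [exact: measurable_snd|exact: measurable_fst].
rewrite normal_density; last 2 first.
- exact: (measurable_fun_fubini_tonelli_F _ madd).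
- by move=> t; apply: integral_ge0.
(* The substitution v = u + t in the inner integral, made before the order of integration is
   exchanged. *)
transitivity (\int[mu]_t \int[mu]_v
    (f v * (normal_pdf 0 1 (v - t) * normal_pdf 0 s t)%:E))%E.
  apply: eq_integral => t _; rewrite normal_density//.
  rewrite -(lebesgue_shift (- t)); last 2 first.
  - exact: emeasurable_funM.
  - by move=> u; rewrite mule_ge0.
  rewrite -ge0_integralZr//; last 2 first.
  - have m1 : measurable_fun setT (fun u : R => u - t).
      by apply: measurable_funD => //; exact: measurable_cst.
    apply: emeasurable_funM.
      exact: (measurableT_comp (mshift t) m1).
    exact: (measurableT_comp (mpdf 0 1) m1).
  - by move=> u _; rewrite mule_ge0.
  by apply: eq_integral => v _; rewrite subrK EFinM muleA.
have mpair : measurable_fun setT (fun tv : R * R =>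
    (f tv.2 * (normal_pdf 0 1 (tv.2 - tv.1) * normal_pdf 0 s tv.1)%:E)%E).
  apply: emeasurable_funM.
    by apply: measurableT_comp => //; exact: measurable_snd.
  apply/measurable_EFinP; apply: measurable_funM.
    apply: measurableT_comp; first exact: measurable_normal_pdf.
    by apply: measurable_funB; [exact: measurable_snd|exact: measurable_fst].
  apply: measurableT_comp; first exact: measurable_normal_pdf.
  exact: measurable_fst.
rewrite (@fubini_tonelli _ _ _ _ _ mu mu _ mpair); last first.
  by move=> x; rewrite mule_ge0// lee_fin mulr_ge0// normal_pdf_ge0.
rewrite normal_density//; apply: eq_integral => v _ /=.
under eq_integral do rewrite normal_pdf_convolution// EFinM muleA.
rewrite ge0_integralZl//.
- by rewrite integral_normal_pdf mule1.
- exact: mpdf.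
- by rewrite mule_ge0.
Qed.

End normal.

(** * Weighted log-sum-exp and concavity of the logarithm *)

Section log_sum_exp.
Context {R : realType} {S : finType}.
Variable w : S -> R.
Hypotheses (w0 : forall s, 0 <= w s) (w1 : \sum_s w s = 1).

Definition lse (e : S -> R) : R := ln (\sum_s w s * expR (e s)).

(** The weights sum to one, so they cannot all vanish. Positivity is what allows [lse] to be undone
    by [expR]. *)
Lemma sum_expR_gt0 e : 0 < \sum_s w s * expR (e s).
Proof.
have we0 s : 0 <= w s * expR (e s) by rewrite mulr_ge0// expR_ge0.
rewrite lt_neqAle sumr_ge0// andbT eq_sym; apply/eqP => we.
have /eqP := w1; rewrite big1 ?(eq_sym 0) ?oner_eq0// => s _.
move/eqP: we; rewrite psumr_eq0// => /allP/(_ s (mem_index_enum s)).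
by rewrite mulf_eq0 (gt_eqF (expR_gt0 _)) orbF => /eqP.
Qed.

Lemma expR_lse e : expR (lse e) = \sum_s w s * expR (e s).
Proof. by rewrite lnK// posrE sum_expR_gt0. Qed.

(** Monotonicity and compatibility with added constants in one inequality; used in both directions
    it makes [lse] 1-Lipschitz for the maximum norm. *)
Lemma lse_le e e' h : (forall s, e s <= e' s + h) -> lse e <= lse e' + h.
Proof.
move=> ee'; rewrite -ler_expR expRD !expR_lse mulr_suml.
by apply: ler_sum => s _; rewrite -mulrA -expRD ler_wpM2l// ler_expR.
Qed.

Lemma lse_lipschitz e e' h : (forall s, `|e s - e' s| <= h) ->
  `|lse e - lse e'| <= h.
Proof.
move=> ee'; rewrite ler_distl; apply/andP; split.
  rewrite lerBlDr; apply: lse_le => s.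
  by have := ee' s; rewrite distrC => /ler_distlDr.
by apply: lse_le => s; have := ee' s => /ler_distlDr.
Qed.

Lemma lse0 : lse (fun=> 0) = 0.
Proof.
by rewrite /lse; under eq_bigr do rewrite expR0 mulr1; rewrite w1 ln1.
Qed.

Lemma lse_norm_le e h : (forall s, `|e s| <= h) -> `|lse e| <= h.
Proof.
move=> eh; rewrite -[lse e]subr0 -lse0; apply: lse_lipschitz => s.
by rewrite subr0.
Qed.

Lemma measurable_lse d (T : measurableType d) (e : T -> S -> R) :
  (forall s, measurable_fun setT (fun t => e t s)) ->
  measurable_fun setT (fun t => lse (e t)).
Proof.
move=> me; apply: measurableT_comp; first exact: measurable_ln.
apply: measurable_sum => s; apply: measurable_funM; first exact: measurable_cst.
by apply: measurableT_comp (me s); exact: measurable_expR.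
Qed.

End log_sum_exp.

(** The graph of [ln] lies below its tangent at the convex combination [q], and the weighted sum of
    the two linear terms is zero. *)
Lemma ln_concave (R : realType) (l a b : R) : 0 <= l <= 1 -> 0 < a -> 0 < b ->
  l * ln a + (1 - l) * ln b <= ln (l * a + (1 - l) * b).
Proof.
move=> /andP[l0 l1] a0 b0.
set q := _ * a + _.
have q0 : 0 < q by rewrite /q; nra.
have ln_div c : 0 < c -> ln c - ln q <= c / q - 1.
  move=> c0; rewrite -ln_div ?posrE//.
  have cq0 : 0 < c / q by rewrite divr_gt0.
  by have := @le_ln1Dx _ (c / q - 1); rewrite (addrC 1) subrK; apply; lra.
have ha := ln_div a a0; have hb := ln_div b b0.
have : l * (a / q - 1) + (1 - l) * (b / q - 1) = 0.
  by rewrite /q; field; rewrite gt_eqF.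
nra.
Qed.

(** * Replacing shared variables by fresh copies *)

Section decoupling.
Context {R : realType} {A S K : finType}.
Variables (w : S -> R) (c : S -> K -> A) (beta : R).
Hypotheses (w0 : forall s, 0 <= w s) (w1 : \sum_s w s = 1).
Hypothesis c_inj : forall s, injective (c s).
Local Notation V := (A + S * K)%type.
Implicit Types (D : {set S * K}) (x : prodR R V).

(* [inl a] indexes the shared variables, [inr (s, k)] the fresh copies; [D] is
   the set of pairs already decoupled. *)
Definition mix_coord D s k : V :=
  if (s, k) \in D then inr (s, k) else inl (c s k).

Definition mix_lse D x : R :=
  lse w (fun s => beta * \sum_k x (mix_coord D s k)).

Lemma mix_coord_inj D s : injective (mix_coord D s).
Proof.
move=> k l; rewrite /mix_coord; case: ifP => _; case: ifP => _ // [].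
  by [].
exact: c_inj.
Qed.

Lemma sum_coord_norm_le (I : finType) (x : prodR R I) (g : K -> I) :
  injective g -> `|\sum_k x (g k)| <= \sum_i `|x i|.
Proof.
move=> gI; apply: le_trans (ler_norm_sum _ _ _) _.
rewrite (bigID [in codom g])/= -[leLHS]addr0 lerD ?sumr_ge0//.
have ug : uniq (codom g) by apply/injectiveP.
by rewrite -(big_uniq _ ug) big_image.
Qed.

(** Since [g] is injective, the coordinate [a] occurs at most once, so [u] enters with coefficient 0
    or 1. *)
Lemma sum_coord_upd (I : finType) (x : prodR R I) (g : K -> I) a u :
  injective g ->
  \sum_k upd x a u (g k) = \sum_k upd x a 0 (g k) + u * (a \in codom g)%:R.
Proof.
move=> gI; have [/codomP[k ->]|ag] := boolP (a \in codom g).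
  rewrite (bigD1 k)//= [in RHS](bigD1 k)//= /upd eqxx add0r mulr1 addrC.
  congr (_ + _); apply: eq_bigr => l lk.
  by rewrite (inj_eq gI) (negbTE lk).
rewrite mulr0 addr0; apply: eq_bigr => k _; rewrite /upd.
by case: eqP => // gk; rewrite -gk codom_f in ag.
Qed.

Lemma lse_coord_subexp (I : finType) (g : S -> K -> I) :
  (forall s, injective (g s)) ->
  subexp (fun x : prodR R I => lse w (fun s => beta * \sum_k x (g s k))).
Proof.
move=> gI; split.
  apply: measurable_lse => s; apply: measurable_funM; first exact: measurable_cst.
  by apply: measurable_sum => k; exact: measurable_coord.
exists `|beta|, 1; split => // x; apply: lse_norm_le => // s.
rewrite normrM ler_wpM2l// mul1r; apply: le_trans (sum_coord_norm_le x (gI s)) _.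
by apply: le_trans (expR_ge1Dx _); rewrite lerDr.
Qed.

Lemma lse_coord_lipschitz (I : finType) (g : S -> K -> I) :
  (forall s, injective (g s)) -> coord_lipschitz `|beta|
    (fun x : prodR R I => lse w (fun s => beta * \sum_k x (g s k))).
Proof.
move=> gI x a u v; apply: lse_lipschitz => // s.
rewrite (sum_coord_upd x a u (gI s)) (sum_coord_upd x a v (gI s)).
set e := \sum_k _; rewrite -mulrBr normrM ler_wpM2l//.
have -> : e + u * (a \in codom (g s))%:R - (e + v * (a \in codom (g s))%:R)
  = (u - v) * (a \in codom (g s))%:R by ring.
by case: (a \in _); rewrite ?mulr1 ?mulr0 ?normr0.
Qed.

Lemma mix_lse_subexp D : subexp (mix_lse D).
Proof. by apply: lse_coord_subexp => s; exact: mix_coord_inj. Qed.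

Section step.
Variables (D : {set S * K}) (s0 : S) (k0 : K).
Hypothesis sk0 : (s0, k0) \notin D.
Let a : V := inl (c s0 k0).
Let b : V := inr (s0, k0).
Let D' := (s0, k0) |: D.

(** Here [a] is the shared variable and [b] the fresh copy used by [s0] alone. The weight [l]
    depends on [x] but not on [u] and [v], which allows integrating over both. *)
Lemma mix_lse_concave x : exists l : R, forall u v,
  l * mix_lse D (upd x a v) + (1 - l) * mix_lse D (upd x a u)
    <= mix_lse D' (upd (upd x b v) a u).
Proof.
(* [e t] is the exponent of [t] with [a] set to zero, and [U t] records whether [t] still uses
   [a]. *)
pose e t := \sum_k upd x a 0 (mix_coord D t k).
pose U t := a \in codom (mix_coord D t).
have eD u t : \sum_k upd x a u (mix_coord D t k) = e t + u * (U t)%:R.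
  exact: sum_coord_upd (@mix_coord_inj D t).
have a_s0 : mix_coord D s0 k0 = a by rewrite /mix_coord (negbTE sk0).
have Us0 : U s0 by rewrite /U -a_s0 codom_f.
have eD' u v t : t != s0 ->
    \sum_k upd (upd x b v) a u (mix_coord D' t k) = e t + u * (U t)%:R.
  move=> ts; rewrite -eD; apply: eq_bigr => k _.
  have -> : mix_coord D' t k = mix_coord D t k.
    by rewrite /mix_coord /D' !inE xpair_eqE (negbTE ts).
  rewrite /upd; case: ifP => // _; case: eqP => // tb.
  by move: tb ts; rewrite /mix_coord; case: ifP => // _ [->]; rewrite eqxx.
have eD's0 u v :
    \sum_k upd (upd x b v) a u (mix_coord D' s0 k) = e s0 + v.
  have x0 : upd x a 0 (mix_coord D s0 k0) = 0 by rewrite a_s0 /upd eqxx.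
  have xb : upd (upd x b v) a u (mix_coord D' s0 k0) = v.
    by rewrite /mix_coord /D' setU11 /upd (_ : b == a = false)// eqxx.
  rewrite /e (bigD1 k0)//= xb [in RHS](bigD1 k0)//= x0 add0r addrC.
  congr (_ + _).
  apply: eq_bigr => k kk0.
  have -> : mix_coord D' s0 k = mix_coord D s0 k.
    by rewrite /mix_coord /D' !inE xpair_eqE eqxx (negbTE kk0).
  have /negbTE ka : mix_coord D s0 k != a.
    by rewrite -a_s0 (inj_eq (@mix_coord_inj D s0)).
  rewrite /upd ka; case: eqP => // kb.
  by move: kb kk0; rewrite /mix_coord; case: ifP => // _ [->]; rewrite eqxx.
pose al t := w t * expR (beta * e t).
have al0 t : 0 <= al t by rewrite mulr_ge0// expR_ge0.
(* [B] collects the other indices that use [a], and [rho] those that do not. Before the step [s0]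
   contributes to the factor of exp (beta u); afterwards its term carries [v] instead. *)
pose B := \sum_(t | (t != s0) && U t) al t.
pose rho := \sum_(t | (t != s0) && ~~ U t) al t.
have B0 : 0 <= B by exact: sumr_ge0.
have restE u : \sum_(t | t != s0) w t * expR (beta * (e t + u * (U t)%:R))
    = B * expR (beta * u) + rho.
  rewrite (bigID U)/= mulr_suml; congr (_ + _); apply: eq_bigr => t /andP[_].
    by move=> ->; rewrite mulr1 mulrDr expRD mulrA.
  by move=> /negbTE ->; rewrite mulr0 addr0.
have ZD u : \sum_t w t * expR (beta * \sum_k upd x a u (mix_coord D t k))
    = (al s0 + B) * expR (beta * u) + rho.
  under eq_bigr do rewrite eD.
  rewrite (bigD1 s0)//= restE Us0 mulr1 mulrDr expRD /al; ring.
have ZD' u v :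
    \sum_t w t * expR (beta * \sum_k upd (upd x b v) a u (mix_coord D' t k))
    = al s0 * expR (beta * v) + (B * expR (beta * u) + rho).
  rewrite (bigD1 s0)//= eD's0 mulrDr expRD mulrA -restE; congr (_ + _).
  by apply: eq_bigr => t ts; rewrite eD'.
(* When both weights vanish, [l] is [0 / 0 = 0] and any value would do. *)
pose l := al s0 / (al s0 + B).
have lB : l * (al s0 + B) = al s0.
  have [ab|ab] := eqVneq (al s0 + B) 0; last by rewrite /l divfK.
  rewrite ab mulr0; have := al0 s0; lra.
have l01 : 0 <= l <= 1.
  rewrite divr_ge0 ?addr_ge0//=.
  have [ab|ab] := eqVneq (al s0 + B) 0; first by rewrite /l ab invr0 mulr0.
  rewrite ler_pdivrMr ?mul1r ?lerDl// lt_neqAle eq_sym ab addr_ge0//.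
exists l => u v.
have pos y D1 : 0 < \sum_t w t * expR (beta * \sum_k y (mix_coord D1 t k)).
  exact: sum_expR_gt0.
have posD t : 0 < (al s0 + B) * expR (beta * t) + rho by rewrite -ZD.
have lseD t : mix_lse D (upd x a t) = ln ((al s0 + B) * expR (beta * t) + rho).
  by rewrite -ZD.
have -> : mix_lse D' (upd (upd x b v) a u) =
    ln (al s0 * expR (beta * v) + (B * expR (beta * u) + rho)).
  by rewrite -ZD'.
rewrite !lseD; apply: le_trans (ln_concave l01 (posD v) (posD u)) _.
rewrite le_eqVlt; apply/orP; left; apply/eqP; congr ln.
have -> : l * ((al s0 + B) * expR (beta * v) + rho) +
    (1 - l) * ((al s0 + B) * expR (beta * u) + rho) =
    l * (al s0 + B) * expR (beta * v) +
    ((al s0 + B) - l * (al s0 + B)) * expR (beta * u) + rho by ring.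
by rewrite lB; ring.
Qed.

Variables (p : probability R R) (m : probability (prodR R V) R).
Hypothesis p_exp : exp_moments p.
Hypothesis mP : prod_law (fun=> p) m.

(** The pointwise bound is integrated over independent [u] and [v] of the same law [p]; the weights
    [l] and 1 - l recombine to the plain average of [mix_lse D]. *)
Lemma mix_lse_step : \int[m]_x mix_lse D x <= \int[m]_x mix_lse D' x.
Proof.
have nu_exp : forall v : V, exp_moments ((fun=> p) v) by [].
have GS := mix_lse_subexp D; have GS' := mix_lse_subexp D'.
have GSa := subexp_condE nu_exp a GS; have GSa' := subexp_condE nu_exp a GS'.
rewrite [leLHS](Rintegral_condE nu_exp a mP GS).
rewrite [leRHS](Rintegral_condE nu_exp a mP GS').
rewrite [leRHS](Rintegral_condE nu_exp b mP GSa').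
apply: le_Rintegral => //.
- exact: (subexp_integrable nu_exp mP GSa).
- exact: (subexp_integrable nu_exp mP (subexp_condE nu_exp b GSa')).
move=> x _; have [l le_l] := mix_lse_concave x.
set g := fun u => mix_lse D (upd x a u) in le_l.
have ig : p.-integrable setT (EFin \o g).
  exact: (subexp_upd_integrable nu_exp x a GS).
have icst r : p.-integrable setT (EFin \o cst r).
  exact: finite_measure_integrable_cst.
have iZ r : p.-integrable setT (EFin \o (fun u => r * g u)).
  exact: (integrableZl measurableT r ig).
have pcst r : \int[p]_u r = r.
  by rewrite Rintegral_cst// (_ : fine _ = 1) ?mulr1// [X in fine X]probability_setT.
(* The mean of [g] is split with weights [l] and 1 - l, and only the first part keeps [v] visible,
   to match the outer integral on the right. *)
have -> : condE (fun=> p) a (mix_lse D) x =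
    \int[p]_v (l * g v + (1 - l) * \int[p]_u g u).
  rewrite RintegralD//; last exact: icst.
  by rewrite pcst RintegralZl// -mulrDl addrC subrK mul1r.
apply: le_Rintegral => //.
- exact: (integrableD measurableT (iZ l) (icst _)).
- exact: (subexp_upd_integrable nu_exp x b GSa').
move=> v _; have -> : l * g v + (1 - l) * \int[p]_u g u =
    \int[p]_u (l * g v + (1 - l) * g u).
  by rewrite RintegralD// ?pcst ?RintegralZl//; exact: icst.
apply: le_Rintegral => //.
- exact: (integrableD measurableT (icst _) (iZ (1 - l))).
- exact: (subexp_upd_integrable nu_exp (upd x b v) a GS').
- by move=> u _; exact: le_l.
Qed.

End step.

(** The pairs are added one at a time. At the empty set the exponents share variables; at the full
    set they use disjoint ones. *)
Lemma mix_lse_decouple (p : probability R R) (m : probability (prodR R V) R) :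
  exp_moments p -> prod_law (fun=> p) m ->
  \int[m]_x mix_lse finset.set0 x <= \int[m]_x mix_lse finset.setT x.
Proof.
move=> p_exp mP.
suff h (l : seq (S * K)) : \int[m]_x mix_lse finset.set0 x
    <= \int[m]_x mix_lse [set:: l] x.
  have <- : [set:: enum {: S * K}] = finset.setT.
    by apply/setP => i; rewrite !inE mem_enum.
  exact: h.
elim: l => [|[s k] l IH]; first by rewrite finset.set_nil.
apply: le_trans IH _; rewrite finset.set_cons.
have [skl|skl] := boolP ((s, k) \in [set:: l]).
  by rewrite (finset.setUidPr _)// finset.sub1set.
exact: (mix_lse_step skl p_exp mP).
Qed.

End decoupling.

(** * Sums over disjoint blocks of standard normal variables *)

Section normal_sums.
Context {R : realType}.

Lemma measurable_sum_coord (V : finType) (l : seq V) :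
  measurable_fun setT (fun x : prodR R V => \sum_(a <- l) x a).
Proof. by apply: measurable_sum => a; exact: measurable_coord. Qed.

Lemma sum_seq_upd (V : finType) (x : prodR R V) (l : seq V) a u : a \notin l ->
  \sum_(b <- l) upd x a u b = \sum_(b <- l) x b.
Proof.
move=> al; apply: eq_big_seq => b bl; rewrite /upd.
by case: eqP => // ba; rewrite ba (negbTE al) in bl.
Qed.

(** [H] stands for anything that ignores the summed coordinates; keeping it yields independence
    together with the law of the sum. Each new coordinate is absorbed by one convolution, which
    raises the variance by one. *)
Lemma integral_normal_sum (V : finType) (m : probability (prodR R V) R)
    (v : V) (l : seq V) (H : prodR R V -> \bar R) (f : R -> \bar R) :
  prod_law (fun=> normal 0 1) m -> uniq (v :: l) ->
  measurable_fun setT H -> (forall x, 0 <= H x)%E ->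
  (forall x a u, a \in v :: l -> H (upd x a u) = H x) ->
  measurable_fun setT f -> (forall t, 0 <= f t)%E ->
  (\int[m]_x (H x * f (\sum_(a <- v :: l) x a)%R) =
   \int[m]_x H x * \int[normal 0 (Num.sqrt (size l).+1%:R)]_t f t)%E.
Proof.
move=> mP; elim: l v f => [|b l IH] v f ul mH H0 HI mf f0.
  rewrite (prod_law_ge0_integral v mP); last 2 first.
  - apply: emeasurable_funM => //.
    exact: (measurableT_comp mf (measurable_sum_coord [:: v])).
  - by move=> x; rewrite mule_ge0.
  rewrite sqrtr1 -ge0_integralZr//; last exact: integral_ge0.
  apply: eq_integral => x _; rewrite -ge0_integralZl//.
  apply: eq_integral => u _; rewrite HI ?inE// big_seq1.
  by rewrite /upd eqxx.
move: ul; rewrite cons_uniq => /andP[vl ul].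
(* Integrating out [v] first turns [f] into its Gaussian smoothing, to which the induction
   hypothesis applies. *)
pose f' t := (\int[normal 0 1]_u f (u + t)%R)%E.
have mf' : measurable_fun setT f'.
  have madd : measurable_fun setT (fun tu : R * R => f (tu.2 + tu.1)).
    apply: measurableT_comp => //.
    by apply: measurable_funD; [exact: measurable_snd|exact: measurable_fst].
  exact: (measurable_fun_fubini_tonelli_F _ madd).
rewrite (prod_law_ge0_integral v mP); last 2 first.
- apply: emeasurable_funM => //.
  exact: (measurableT_comp mf (measurable_sum_coord _)).
- by move=> x; rewrite mule_ge0.
transitivity (\int[m]_x (H x * f' (\sum_(a <- b :: l) x a)%R))%E.
  apply: eq_integral => x _; rewrite /f' -ge0_integralZl//; last first.
    apply: measurableT_comp => //.
    by apply: measurable_funD => //; exact: measurable_cst.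
  apply: eq_integral => u _; rewrite HI ?mem_head//; congr (_ * f _)%E.
  by rewrite big_cons sum_seq_upd// /upd eqxx.
have HI' x a u : a \in b :: l -> H (upd x a u) = H x.
  by move=> al; rewrite HI// in_cons al orbT.
have f0' t : (0 <= f' t)%E by exact: integral_ge0.
rewrite (IH b f' ul mH H0 HI' mf' f0').
have k0 : Num.sqrt (size l).+1%:R != 0 :> R by rewrite gt_eqF// sqrtr_gt0.
have sE : Num.sqrt (Num.sqrt (size l).+1%:R ^+ 2 + 1) =
    Num.sqrt (size l).+2%:R :> R.
  have h : 0 <= (size l).+1%:R :> R by [].
  by rewrite (sqr_sqrtr h) (natr1 (size l).+1).
have := normal_convolution k0 mf f0; rewrite sE => conv.
exact: (congr1 (mule _) conv).
Qed.

Lemma prod_law_marginal (A B : finType) (nu : A + B -> probability R R)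
    (m : probability (prodR R (A + B)%type) R) (C : A -> set R) :
  prod_law nu m -> (forall a, measurable (C a)) ->
  m [set x | forall a, C a (x (inl a))] = (\prod_a nu (inl a) (C a))%E.
Proof.
move=> mP mC; pose C' (v : A + B) := if v is inl a then C a else setT.
rewrite (_ : [set x | _] = box C'); last first.
  by apply/seteqP; split => x /= Cx; [case=> //= a|move=> a; exact: (Cx (inl a))].
rewrite mP; last by case=> //= b; exact: measurableT.
rewrite big_sumType/= [X in (_ * X)%E]big1 ?mule1// => b _.
exact: probability_setT.
Qed.

(** The disjoint blocks are integrated out one at a time, the product over the remaining blocks
    serving as [H]. For empty [K] the normal law on the right would have deviation 0 and be a
    default value instead of a point mass. *)
Lemma prod_law_normal_sums (A S K : finType)
    (m : probability (prodR R (A + S * K)%type) R) (C : S -> set R) :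
  (0 < #|K|)%N -> prod_law (fun=> normal 0 1) m ->
  (forall s, measurable (C s)) ->
  m [set x | forall s, C s (\sum_k x (inr (s, k)))] =
  (\prod_s normal 0 (Num.sqrt #|K|%:R) (C s))%E.
Proof.
move=> K0 mP mC; pose V := (A + S * K)%type.
have [k [l [kl ek]]] : exists k l, uniq (k :: l) /\ enum K = k :: l.
  move: K0 (enum_uniq K); rewrite cardE; case: (enum K) => // k l _ kl.
  by exists k, l.
have sz : #|K| = (size l).+1 by rewrite cardE ek.
pose sl s : seq V := [seq inr (s, k) | k <- k :: l].
have sumE x s : \sum_k x (inr (s, k)) = \sum_(a <- sl s) x a :> R.
  by rewrite big_map -ek big_enum.
pose F (L : seq S) (x : prodR R V) : \bar R :=
  (\prod_(s <- L) (\1_(C s) (\sum_(a <- sl s) x a))%:E)%E.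
have mi s : measurable_fun setT (EFin \o \1_(C s) : R -> \bar R).
  by apply/measurable_EFinP; exact: measurable_indic.
have mF L : measurable_fun setT (F L).
  elim: L => [|s L IH].
    by apply: eq_measurable_fun (measurable_cst 1%E) => x _; rewrite /F big_nil.
  have msL : measurable_fun setT (fun x : prodR R V =>
      ((EFin \o \1_(C s)) (\sum_(a <- sl s) x a)%R * F L x)%E).
    apply: emeasurable_funM => //.
    exact: (measurableT_comp (mi s) (measurable_sum_coord (sl s))).
  by apply: eq_measurable_fun msL => x _; rewrite /F [RHS]big_cons.
have F0 L x : (0 <= F L x)%E by apply: prode_ge0 => s _; rewrite lee_fin.
have FE L : uniq L -> (\int[m]_x F L x =
    \prod_(s <- L) normal 0 (Num.sqrt #|K|%:R) (C s))%E.
  elim: L => [_|s L IH /=/andP[sL uL]].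
    rewrite big_nil /F; under eq_integral do rewrite big_nil.
    by rewrite integral_cst// mul1e; exact: probability_setT.
  rewrite big_cons -(IH uL).
  transitivity (\int[m]_x (F L x * (EFin \o \1_(C s)) (\sum_(a <- sl s) x a)%R))%E.
    by apply: eq_integral => x _; rewrite /F [LHS]big_cons muleC.
  have usl : uniq (inr (s, k) :: [seq inr (s, k) | k <- l] : seq V).
    by rewrite -[X in uniq X]/(sl s) map_inj_uniq// => ? ? [].
  have FI x a u : a \in (inr (s, k) :: [seq inr (s, k) | k <- l] : seq V) ->
      F L (upd x a u) = F L x.
    move=> al; apply: eq_big_seq => t tL; rewrite sum_seq_upd//.
    apply/negP => atl; move: al atl; rewrite -[X in a \in X -> _]/(sl s).
    by move=> /mapP[k1 _ ->] /mapP[k2 _ [st _]]; rewrite st tL in sL.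
  have i0 t : (0 <= (EFin \o \1_(C s)) t :> \bar R)%E by rewrite lee_fin.
  rewrite (integral_normal_sum mP usl (mF L) (F0 L) FI (mi s) i0).
  by rewrite muleC size_map -sz integral_indic// setIT.
pose E : set (prodR R V) := [set x | forall s, C s (\sum_k x (inr (s, k)))].
rewrite -[RHS]big_enum -FE ?enum_uniq// -[LHS]/(m E).
have mE : measurable E.
  rewrite -[E]setTI; pose phi (x : prodR R V) : prodR R S :=
    fun s => \sum_k x (inr (s, k)).
  have mphi : measurable_fun setT phi.
    apply: measurable_into_prodR => s; apply: measurable_sum => i.
    exact: measurable_coord.
  exact: (mphi measurableT _ (measurable_box mC)).
rewrite -[E]setIT -integral_indic//.
apply: eq_integral => x _; rewrite /F big_enum indicE.
have [xE|] := boolP (x \in E).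
  rewrite big1// => s _; rewrite -sumE indicE mem_set//.
  by move: xE; rewrite inE => /(_ s).
rewrite notin_setE => /existsNP[s Cs]; rewrite (bigD1 s)//= -sumE indicE.
by rewrite memNset// mul0e.
Qed.

End normal_sums.

(** * From random variables to laws on the product space *)

Section joint_law.
Context {R : realType} {d} {T : measurableType d} {Q : probability T R}.
Context {I : finType}.

Definition joint (X : I -> {RV Q >-> R}) (t : T) : prodR R I := fun i => X i t.

Lemma measurable_joint X : measurable_fun setT (joint X).
Proof. by apply: measurable_into_prodR => i; exact: measurable_funPT. Qed.

HB.instance Definition _ X :=
  isMeasurableFun.Build _ _ _ _ (joint X) (measurable_joint X).

Definition joint_law (X : I -> {RV Q >-> R}) : probability (prodR R I) R :=
  distribution Q (joint X : {RV Q >-> prodR R I}).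

Lemma prod_law_joint (X : I -> {RV Q >-> R}) (mean sigma : I -> R) :
  mutually_independent X ->
  (forall i, normally_distributed (X i) (mean i) (sigma i)) ->
  prod_law (fun i => normal (mean i) (sigma i)) (joint_law X).
Proof.
move=> Xi Xn B mB; have := Xi finset.setT B mB.
have -> : \bigcap_(i in [set` finset.setT]) (X i @^-1` B i) = joint X @^-1` box B.
  apply/seteqP; split => t /= Bt; first by move=> i; apply: Bt; rewrite /= inE.
  by move=> i _; exact: Bt.
move=> QB; rewrite -[LHS]/(Q (joint X @^-1` box B)) QB.
rewrite (eq_bigl xpredT) => [|i]; last by rewrite inE.
by apply: eq_bigr => i _; exact: (Xn i _ (mB i)).
Qed.

(** Change of variables to the product space. The equation is in the extended reals, where
    expectations live; the growth bound on [F] makes the value finite. *)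
Lemma integral_joint (X : I -> {RV Q >-> R}) nu (F : prodR R I -> R) :
  (forall i, exp_moments (nu i)) -> prod_law nu (joint_law X) -> subexp F ->
  (\int[Q]_t (F (joint X t))%:E = (\int[joint_law X]_x F x)%:E)%E.
Proof.
move=> nu_exp XP Fs; have mF : measurable_fun setT (EFin \o F).
  by apply/measurable_EFinP; case: Fs.
have iF := subexp_integrable nu_exp XP Fs.
rewrite /Rintegral fineK; last exact: (integrable_fin_num measurableT iF).
rewrite -[X in X = _]/(\int[Q]_t ((EFin \o F) \o joint X) t)%E.
rewrite -integral_distribution//; apply/integrableP; split.
  exact: measurableT_comp.
have /integrableP[_] := iF; rewrite ge0_integral_distribution//.
exact: measurableT_comp.
Qed.

End joint_law.

(** * Change of measure between Gaussian product laws *)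

Section gaussian_shift.
Context {R : realType} {I : finType}.
Variables (mean : I -> R) (m0 m1 : probability (prodR R I) R).
Hypothesis m0P : prod_law (fun=> normal 0 1) m0.
Hypothesis m1P : prod_law (fun i => normal (mean i) 1) m1.

Definition likelihood (x : prodR R I) : R :=
  \prod_i expR (mean i * x i - mean i ^+ 2 / 2).

Lemma likelihood_gt0 x : 0 < likelihood x.
Proof. by apply: prodr_gt0 => i _; exact: expR_gt0. Qed.

Let lik1 (i : I) (u : R) : \bar R := (expR (mean i * u - mean i ^+ 2 / 2))%:E.

Let mlik1 i : measurable_fun setT (lik1 i).
Proof.
apply/measurable_EFinP; apply: measurableT_comp; first exact: measurable_expR.
by apply: measurable_funB; [exact: measurable_funM|exact: measurable_cst].
Qed.

Let likelihoodE x : (likelihood x)%:E = (\prod_i lik1 i (x i))%E.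
Proof. by rewrite -prodEFin. Qed.

Lemma measurable_likelihood : measurable_fun setT likelihood.
Proof.
apply/measurable_EFinP; apply: eq_measurable_fun
  (measurable_prod_coord (index_enum I) mlik1).
by move=> x _; rewrite /= likelihoodE.
Qed.

(** The measure with density [likelihood], given a measure structure below so that uniqueness on
    boxes can identify it with [m1]. *)
Definition shifted (A : set (prodR R I)) : \bar R :=
  (\int[m0]_(x in A) (likelihood x)%:E)%E.

Let shifted0 : shifted set0 = 0%E.
Proof. exact: integral_set0. Qed.

Let shifted_ge0 A : (0 <= shifted A)%E.
Proof. by apply: integral_ge0 => x _; rewrite lee_fin ltW// likelihood_gt0. Qed.

Let shifted_sigma_additive : semi_sigma_additive shifted.
Proof.
move=> F mF tF mUF; rewrite /shifted ge0_integral_bigcup//.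
- apply: is_cvg_ereal_nneg_natsum_cond => n _ _; exact: shifted_ge0.
- by apply: measurable_funTS; apply/measurable_EFinP; exact: measurable_likelihood.
- by move=> x _; rewrite lee_fin ltW// likelihood_gt0.
Qed.

HB.instance Definition _ := isMeasure.Build _ _ _
  shifted shifted0 shifted_ge0 shifted_sigma_additive.

Lemma shiftedE A : measurable A -> m1 A = shifted A.
Proof.
apply: prodR_measure_unique; first by rewrite /= probability_setT ltry.
move=> B mB /=; rewrite m1P// /shifted.
pose f i u := (lik1 i u * (\1_(B i) u)%:E)%E.
have mf i : measurable_fun setT (f i).
  by apply: emeasurable_funM => //; apply/measurable_EFinP; exact: measurable_indic.
have f0 i u : (0 <= f i u)%E by rewrite mule_ge0// lee_fin expR_ge0.
transitivity (\int[m0]_x \prod_i f i (x i))%E.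
  rewrite (prod_law_prod m0P)// ?index_enum_uniq//.
  apply: eq_bigr => i _; rewrite normal_density//.
  rewrite -[LHS]/(normal_prob (mean i) 1 (B i)) /normal_prob integral_mkcond.
  apply: eq_integral => u _; rewrite patchE /f indicE.
  case: ifPn => _; last by rewrite mule0 mul0e.
  (* Tilting the standard normal density by [mean i] produces the exponential of half the squared
     mean, which the normalisation in [lik1] cancels. *)
  rewrite mule1 -EFinM expRB mulrAC normal_pdf_tilt ?oner_eq0//.
  rewrite mulr0 !add0r expr1n !mulr1 mulrAC divff ?mul1r// gt_eqF ?expR_gt0//.
rewrite [RHS]integral_mkcond; apply: eq_integral => x _; rewrite patchE.
have [xB|] := boolP (x \in box B).
  rewrite likelihoodE; apply: eq_bigr => i _; rewrite /f indicE mem_set ?mule1//.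
  by move: xB; rewrite inE => /(_ i).
rewrite notin_setE => /existsNP[i Bi]; rewrite (bigD1 i)//= /f indicE.
by rewrite memNset// mule0 mul0e.
Qed.

End gaussian_shift.

(** * A one-sided Chebyshev inequality *)

Section chebyshev.
Context {R : realType} {I : finType}.

(** On the event, t^2 is at most (F - f)^2, whose integral is the variance bounded by [variance_le].
    The square is kept expanded so that the integral splits term by term. *)
Lemma subexp_chebyshev (nu : I -> probability R R) (m : probability (prodR R I) R)
    (F : prodR R I -> R) L c t :
  (forall i, exp_moments (nu i)) -> prod_law nu m -> subexp F -> 0 <= L ->
  coord_lipschitz L F -> (forall a, \int[nu a]_u (u ^+ 2) <= c) -> 0 < t ->
  fine (m [set x | \int[m]_x F x + t < F x]) <= L ^+ 2 * c *+ #|I| / t ^+ 2.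
Proof.
move=> nu_exp mP Fs L0 FL nuc t0; set f := \int[m]_x F x; set A := [set x | _].
have mA : measurable A.
  rewrite -[A]setTI (_ : A = F @^-1` `]f + t, +oo[%classic); last first.
    by apply/seteqP; split => x /=; rewrite in_itv/= andbT.
  by case: Fs => mF _; exact: mF.
have iF : m.-integrable setT (EFin \o F) := subexp_integrable nu_exp mP Fs.
have iF2 : m.-integrable setT (EFin \o (fun x => F x ^+ 2)) :=
  subexp_integrable nu_exp mP (subexp_sqr Fs).
have iZ : m.-integrable setT (EFin \o (fun x => 2 * f * F x)).
  exact: (integrableZl measurableT _ iF).
have iB : m.-integrable setT (EFin \o (fun x => F x ^+ 2 - 2 * f * F x)).
  exact: (integrableB measurableT iF2 iZ).
have icst : m.-integrable setT (EFin \o cst (f ^+ 2)).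
  exact: finite_measure_integrable_cst.
have iA : m.-integrable setT (EFin \o \1_A) by exact: integrable_indic.
have h : \int[m]_x (t ^+ 2 * \1_A x)
    <= \int[m]_x (F x ^+ 2 - 2 * f * F x + f ^+ 2).
  apply: le_Rintegral => //.
  - exact: (integrableZl measurableT _ iA).
  - exact: (integrableD measurableT iB icst).
  move=> x _; rewrite indicE; have [|xA] := boolP (x \in A).
    rewrite inE /A /= => Ax; rewrite mulr1 -/f in Ax *.
    have : 0 <= (F x - f - t) * (F x - f + t) by rewrite mulr_ge0//; lra.
    lra.
  by rewrite mulr0; have := sqr_ge0 (F x - f); lra.
have m1 : fine (m setT) = 1 by rewrite [X in fine X]probability_setT.
have AE : \int[m]_x \1_A x = fine (m A).
  by rewrite /Rintegral integral_indic// setIT.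
rewrite RintegralZl// AE in h.
rewrite RintegralD// RintegralB// Rintegral_cst// m1 RintegralZl// -/f in h.
have := variance_le nu_exp mP Fs L0 FL nuc; rewrite -/f => v.
by rewrite ler_pdivlMr ?exprn_gt0//; nra.
Qed.

End chebyshev.

(** * The likelihood ratio and the threshold test *)

Section testing.
Context {R : realType} {M N : nat}.
Local Notation I := ('I_M * 'I_N)%type.
Local Notation S := (N.-tuple 'I_M).

Definition entries (P : probability (data R M N) R) (mn : I) : {RV P >-> R} :=
  entry mn.1 mn.2.

(** Left inverse of the map listing the entries; it carries events on the data to the product space,
    where the change of measure is available. *)
Definition data_of (x : prodR R I) : data R M N :=
  [tuple [tuple x (m, n) | m < M] | n < N].

Lemma measurable_data_of : measurable_fun setT data_of.
Proof.
apply/measurable_fun_tnthP => n; apply/measurable_fun_tnthP => m.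
apply: eq_measurable_fun (measurable_coord (m, n)) => x _.
by rewrite /= !tnth_mktuple.
Qed.

Lemma joint_entriesK P y : data_of (joint (entries P) y) = y.
Proof.
apply: eq_from_tnth => n; apply: eq_from_tnth => m.
by rewrite !tnth_mktuple.
Qed.

Lemma H0_law_joint P0 : H0_law P0 -> prod_law (fun=> normal 0 1) (joint_law (entries P0)).
Proof. by case=> indep norm; apply: prod_law_joint => // -[m n]; exact: norm. Qed.

Definition path_coord (s : S) (n : 'I_N) : I := (tnth s n, n).

Lemma path_coord_inj s : injective (path_coord s).
Proof. by move=> n n' []. Qed.

Definition path_mean (beta : R) (s : S) (mn : I) : R :=
  if mn.1 == tnth s mn.2 then beta else 0.

(** Each column has exactly one entry of mean [beta], namely [path_coord s n], and so contributes
    one linear term and one beta^2/2. *)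
Lemma path_likelihood beta s x :
  likelihood (path_mean beta s) x =
  expR (beta * \sum_n x (path_coord s n) - N%:R * (beta ^+ 2 / 2)).
Proof.
rewrite /likelihood -expR_sum; congr expR.
transitivity (\sum_(m < M) \sum_(n < N)
    (path_mean beta s (m, n) * x (m, n) - path_mean beta s (m, n) ^+ 2 / 2)).
  by rewrite pair_bigA; apply: eq_bigr => -[m n].
rewrite exchange_big/=.
transitivity (\sum_(n < N) (beta * x (path_coord s n) - beta ^+ 2 / 2)).
  apply: eq_bigr => n _; rewrite (bigD1 (tnth s n))//= {1 2}/path_mean eqxx.
  rewrite big1 ?addr0// => m /negbTE ms.
  by rewrite /path_mean/= ms mul0r expr0n/= mul0r subr0.
by rewrite big_split/= -mulr_sumr sumrN sumr_const card_ord mulr_natl.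
Qed.

Lemma gaussian_data_density (P0 Q : probability (data R M N) R) beta s A :
  H0_law P0 ->
  gaussian_data Q (fun m n => if m == tnth s n then beta else 0) ->
  measurable A ->
  Q A = (\int[P0]_(y in A)
    (likelihood (path_mean beta s) (joint (entries P0) y))%:E)%E.
Proof.
move=> /H0_law_joint m0P [indep norm] mA.
have m1P : prod_law (fun i => normal (path_mean beta s i) 1) (joint_law (entries Q)).
  by apply: prod_law_joint => // -[m n]; exact: norm.
pose B := data_of @^-1` A.
have mB : measurable B by rewrite -[B]setTI; exact: measurable_data_of.
have AE P : joint (entries P) @^-1` B = A.
  by apply/seteqP; split => y /=; rewrite /B /= joint_entriesK.
transitivity (joint_law (entries Q) B); first by rewrite -[in LHS](AE Q).
rewrite (shiftedE m0P m1P mB) /shifted -[in RHS](AE P0).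
rewrite ge0_integral_pushforward//.
- by apply: measurable_funTS; apply/measurable_EFinP; exact: measurable_likelihood.
- by move=> x _; rewrite lee_fin ltW// likelihood_gt0.
Qed.

Variables (w : S -> R) (beta : R) (P0 P1 : probability (data R M N) R).
Hypothesis w0 : forall s, 0 <= w s.
Hypothesis P0_law : H0_law P0.
Hypothesis P1_law : H1_law w beta P1.

(** Under H1 this is the log-likelihood ratio without its deterministic term N beta^2/2. *)
Definition loglik (x : prodR R I) : R :=
  lse w (fun s => beta * \sum_n x (path_coord s n)).

(** The mixture is evaluated on the whole space, where every measure involved has mass one. *)
Lemma H1_law_sum1 : \sum_s w s = 1.
Proof.
have [Q [_ QE]] := P1_law; have := QE setT measurableT.
rewrite probability_setT; under eq_bigr do rewrite probability_setT mule1.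
by rewrite sumEFin => -[].
Qed.

Let loglik_subexp : subexp loglik.
Proof. exact: (lse_coord_subexp _ w0 H1_law_sum1 path_coord_inj). Qed.

(** A mixture has the averaged density, and the factor exp (- N beta^2/2) is common to all paths. *)
Lemma H1_density A : measurable A ->
  P1 A = (\int[P0]_(y in A)
    (expR (loglik (joint (entries P0) y) - N%:R * (beta ^+ 2 / 2)))%:E)%E.
Proof.
move=> mA; have [Q [QG ->//]] := P1_law.
have mlik s : measurable_fun A (fun y =>
    (likelihood (path_mean beta s) (joint (entries P0) y))%:E).
  apply: measurable_funTS; apply/measurable_EFinP.
  by apply: measurableT_comp; [exact: measurable_likelihood|exact: measurable_joint].
have lik0 s y : (0 <= (likelihood (path_mean beta s) (joint (entries P0) y))%:E :> \bar R)%E.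
  by rewrite lee_fin ltW// likelihood_gt0.
transitivity (\sum_s \int[P0]_(y in A) ((w s)%:E *
    (likelihood (path_mean beta s) (joint (entries P0) y))%:E))%E.
  apply: eq_bigr => s _; rewrite (gaussian_data_density P0_law (QG s) mA).
  by rewrite ge0_integralZl// lee_fin.
rewrite -ge0_integral_sum//; last 2 first.
- by move=> s; exact: measurable_funeM.
- by move=> s y _; rewrite mule_ge0// lee_fin.
apply: eq_integral => y _; rewrite expRB (expR_lse w0 H1_law_sum1).
rewrite mulr_suml -sumEFin; apply: eq_bigr => s _.
by rewrite path_likelihood expRB -EFinM; congr EFin; exact: mulrA.
Qed.

Lemma measurable_loglik_gt t :
  measurable [set y | t < loglik (joint (entries P0) y)].
Proof.
rewrite -[X in measurable X]setTI.
rewrite (_ : [set y | _] = (loglik \o joint (entries P0)) @^-1` `]t, +oo[%classic).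
  have [mF _] := loglik_subexp.
  by apply: (measurableT_comp mF (measurable_joint (entries P0))).
by apply/seteqP; split => x /=; rewrite in_itv/= andbT.
Qed.

(** Where H0 is decided the likelihood ratio is at most the right-hand side, and [P0] gives that
    event mass at most one. *)
Lemma miss_threshold_le t :
  miss P1 [set y | t < loglik (joint (entries P0) y)]
    <= expR (t - N%:R * (beta ^+ 2 / 2)).
Proof.
set A := [set y | _]; have mA : measurable A by exact: measurable_loglik_gt.
rewrite /miss -lee_fin fineK ?fin_num_measure//; last exact: measurableC.
rewrite H1_density; last exact: measurableC.
apply: (@le_trans _ _ (\int[P0]_(y in ~` A)
    (expR (t - N%:R * (beta ^+ 2 / 2)))%:E)%E).
  apply: ge0_le_integral => //.
  - exact: measurableC.
  - apply: measurable_funTS; apply/measurable_EFinP.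
    apply: measurableT_comp; first exact: measurable_expR.
    apply: measurable_funB; last exact: measurable_cst.
    have [mF _] := loglik_subexp.
    exact: (measurableT_comp mF (measurable_joint (entries P0))).
  - by move=> y /= /negP; rewrite -leNgt lee_fin ler_expR lerD2r.
rewrite integral_cst; last exact: measurableC.
by rewrite -[leRHS]mule1 lee_wpmul2l ?lee_fin ?expR_ge0// probability_le1//;
  exact: measurableC.
Qed.

(** The density is positive everywhere, so a [P1]-null set is [P0]-null; a null complement would
    force false alarm probability one. Positivity guards the later logarithm against its default
    value at zero. *)
Lemma miss_gt0 A : measurable A -> false_alarm P0 A < 1 -> 0 < miss P1 A.
Proof.
move=> mA A1; have mC := measurableC mA.
rewrite lt_neqAle fine_ge0// andbT eq_sym; apply/negP => /eqP PC.
have P1C : P1 (~` A) = 0%E by rewrite -[LHS]fineK ?fin_num_measure// -/(miss P1 A) PC.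
move: A1; rewrite /false_alarm ltNge => /negP; apply.
suff P0C : P0 (~` A) = 0%E.
  have := probability_setC P0 mA; rewrite P0C.
  rewrite -[P0 A]fineK ?fin_num_measure// -EFinB => -[]; lra.
have mexp : measurable_fun (~` A) (fun y =>
    (expR (loglik (joint (entries P0) y) - N%:R * (beta ^+ 2 / 2)))%:E).
  apply: measurable_funTS; apply/measurable_EFinP.
  apply: measurableT_comp; first exact: measurable_expR.
  apply: measurable_funB; last exact: measurable_cst.
  have [mF _] := loglik_subexp.
  exact: (measurableT_comp mF (measurable_joint (entries P0))).
(* A strictly positive integrand with zero integral confines its domain to a null set [Z]. *)
have /(ae_eq_integral_abs P0 mC mexp)[Z [mZ Z0 CZ]] :
    (\int[P0]_(y in ~` A) `|(expR (loglik (joint (entries P0) y)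
       - N%:R * (beta ^+ 2 / 2)))%:E|)%E = 0%E.
  rewrite -[RHS]P1C H1_density//; apply: eq_integral => y _.
  by rewrite gee0_abs// lee_fin expR_ge0.
apply/eqP; rewrite eq_le measure_ge0 andbT -[leRHS]Z0 le_measure ?inE//.
move=> y Ay; apply: CZ => /= /(_ Ay) [] /eqP.
by rewrite gt_eqF// expR_gt0.
Qed.

End testing.

(** * Comparing the data law with independent path variables *)

Section comparison.
Context {R : realType}.

Lemma Rintegral_prod_law (I : finType) (nu : I -> probability R R)
    (m1 m2 : probability (prodR R I) R) (F : prodR R I -> R) :
  prod_law nu m1 -> prod_law nu m2 -> \int[m1]_x F x = \int[m2]_x F x.
Proof.
move=> m1P m2P; congr fine; apply: eq_measure_integral => A mA _.
exact: (prod_law_unique m1P m2P).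
Qed.

Lemma standard_normal_exp_moments : exp_moments (normal (0 : R) 1).
Proof. by apply: normal_exp_moments; exact: oner_neq0. Qed.

Lemma lse_single_subexp (S : finType) (w : S -> R) beta :
  (forall s, 0 <= w s) -> \sum_s w s = 1 ->
  subexp (fun x : prodR R S => lse w (fun s => beta * x s)).
Proof.
move=> w0 w1; have := @lse_coord_subexp R S unit w beta w0 w1 S (fun s _ => s).
under eq_fun do under eq_fun do rewrite big_const card_unit/= addr0.
by apply => s [] [].
Qed.

Section coords.
Context {A S K : finType}.
Local Notation V := (A + S * K)%type.

Definition left_coord (a : A) (x : prodR R V) : R := x (inl a).

Definition right_sum (s : S) (x : prodR R V) : R := \sum_k x (inr (s, k)).

HB.instance Definition _ a := isMeasurableFun.Build _ _ _ _ (left_coord a)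
  (measurable_coord (inl a)).

Lemma measurable_right_sum s : measurable_fun setT (right_sum s).
Proof. by apply: measurable_sum => k; exact: measurable_coord. Qed.

HB.instance Definition _ s := isMeasurableFun.Build _ _ _ _ (right_sum s)
  (measurable_right_sum s).

End coords.

(** One auxiliary standard normal space carries both sides: its shared coordinates have the law of
    the data, and its block sums are independent N(0, N). They are the two ends of the
    decoupling. *)
Lemma loglik_comparison (M N : nat) (w : N.-tuple 'I_M -> R) beta
    (m0 : probability (prodR R ('I_M * 'I_N)%type) R)
    (m : probability (prodR R (N.-tuple 'I_M)) R) :
  (0 < N)%N -> (forall s, 0 <= w s) -> \sum_s w s = 1 ->
  prod_law (fun=> normal 0 1) m0 ->
  prod_law (fun=> normal 0 (Num.sqrt N%:R)) m ->
  \int[m0]_x loglik w beta x <= \int[m]_x lse w (fun s => beta * x s).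
Proof.
move=> N0 w0 w1 m0P mP.
pose S := N.-tuple 'I_M.
have [mV mVP] := @prod_law_exists R
  ('I_M * 'I_N + S * 'I_N)%type (fun=> normal 0 1).
pose X0 a : {RV mV >-> R} := left_coord a.
pose X1 s : {RV mV >-> R} := right_sum s.
have X0P : prod_law (fun=> normal 0 1) (joint_law X0).
  by move=> B mB; exact: (prod_law_marginal mVP mB).
have X1P : prod_law (fun=> normal 0 (Num.sqrt N%:R)) (joint_law X1).
  move=> B mB; have := @prod_law_normal_sums R _ S 'I_N mV B.
  by rewrite card_ord; apply.
have sN : Num.sqrt N%:R != 0 :> R by rewrite gt_eqF// sqrtr_gt0 ltr0n.
have lse1 := lse_single_subexp beta w0 w1.
have lse0 : subexp (@loglik R M N w beta).
  exact: (lse_coord_subexp _ w0 w1 (@path_coord_inj M N)).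
have e0 := integral_joint (fun=> standard_normal_exp_moments) X0P lse0.
have e1 := integral_joint (fun=> normal_exp_moments 0 sN) X1P lse1.
rewrite (Rintegral_prod_law _ m0P X0P) (Rintegral_prod_law _ mP X1P).
have E0 : \int[mV]_x mix_lse w (@path_coord M N) beta finset.set0 x =
    \int[joint_law X0]_x loglik w beta x.
  apply: etrans (congr1 fine e0); congr fine; apply: eq_integral => x _.
  congr (ln _)%:E; apply: eq_bigr => s _; congr (_ * expR (_ * _)).
  by apply: eq_bigr => n _; rewrite /mix_coord finset.in_set0.
have E1 : \int[mV]_x mix_lse w (@path_coord M N) beta finset.setT x =
    \int[joint_law X1]_x lse w (fun s => beta * x s).
  apply: etrans (congr1 fine e1); congr fine; apply: eq_integral => x _.
  congr (ln _)%:E; apply: eq_bigr => s _; congr (_ * expR (_ * _)).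
  by apply: eq_bigr => n _; rewrite /mix_coord finset.in_setT.
rewrite -E0 -E1; apply: (mix_lse_decouple beta w0 w1 (@path_coord_inj M N) _ mVP).
exact: standard_normal_exp_moments.
Qed.

End comparison.

(** * The bound for fixed N and the passage to the limit *)

Section exponent.
Context {R : realType}.

Lemma path_prob_ge0 (M : nat) (P : 'M[R]_M) (pi : 'rV[R]_M) N (s : N.-tuple 'I_M) :
  stochastic P -> stationary P pi -> 0 <= path_prob P pi s.
Proof.
move=> [P0 _] [pi0 _ _]; rewrite /path_prob; case: (tval s) => // i t.
by rewrite mulr_ge0// prodr_ge0.
Qed.

(** The last hypothesis makes the Chebyshev bound admit the test with threshold f + N c as a
    competitor of [delta]. Optimality then transfers its miss bound to [delta], and decoupling
    replaces [f] by [g]. *)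
Lemma exponent_ge (M N : nat) (w : N.-tuple 'I_M -> R) (beta eps c : R)
    (P0 P1 : probability (data R M N) R) (delta : set (data R M N))
    (d : measure_display) (T : measurableType d) (Q : probability T R)
    (x : N.-tuple 'I_M -> {RV Q >-> R}) :
  (0 < N)%N -> (forall s, 0 <= w s) -> 0 < c -> eps < 1 ->
  H0_law P0 -> H1_law w beta P1 -> optimal_detector eps P0 P1 delta ->
  (forall s, normally_distributed (x s) 0 (Num.sqrt N%:R)) ->
  mutually_independent x ->
  beta ^+ 2 * (\int[normal 0 1]_u (u ^+ 2)) *+ (M * N) / (N%:R * c) ^+ 2 <= eps ->
  beta ^+ 2 / 2 - c - fine (N%:R^-1%:E *
      'E_Q[(fun t => ln (\sum_s w s * expR (beta * x s t)))])%E
    <= - (N%:R^-1 * ln (miss P1 delta)).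
Proof.
move=> N0 w0 c0 eps1 P0_law P1_law [mdelta delta_eps delta_opt] xn xi le_eps.
have NR : 0 < N%:R :> R by rewrite ltr0n.
have w1 := H1_law_sum1 P1_law.
have sN : Num.sqrt N%:R != 0 :> R by rewrite gt_eqF// sqrtr_gt0.
have xP : prod_law (fun=> normal 0 (Num.sqrt N%:R)) (joint_law x).
  exact: prod_law_joint xi xn.
set g := \int[joint_law x]_y lse w (fun s => beta * y s).
have -> : fine (N%:R^-1%:E *
      'E_Q[(fun t => ln (\sum_s w s * expR (beta * x s t)))])%E = N%:R^-1 * g.
  have := integral_joint (fun=> normal_exp_moments 0 sN) xP
    (lse_single_subexp beta w0 w1).
  by rewrite unlock => ->.
have m0P := H0_law_joint P0_law.
set m0 := joint_law _ in m0P.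
have Fs : subexp (@loglik R M N w beta).
  exact: (lse_coord_subexp _ w0 w1 (@path_coord_inj M N)).
have FL : coord_lipschitz `|beta| (@loglik R M N w beta).
  exact: (lse_coord_lipschitz _ w0 w1 (@path_coord_inj M N)).
set f := \int[m0]_y loglik w beta y.
have fg : f <= g by exact: (loglik_comparison beta N0 w0 w1 m0P xP).
pose A := [set y | f + N%:R * c < loglik w beta (joint (entries P0) y)].
have mA : measurable A by exact: (measurable_loglik_gt P0 w0 P1_law).
have A_eps : false_alarm P0 A <= eps.
  apply: le_trans le_eps.
  have := subexp_chebyshev (fun=> standard_normal_exp_moments) m0P Fs
    (normr_ge0 beta) FL (fun=> lexx _) (mulr_gt0 NR c0).
  by rewrite card_prod !card_ord real_normK ?num_real.
have delta_lt1 := le_lt_trans delta_eps eps1.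
have miss0 := miss_gt0 w0 P0_law P1_law mdelta delta_lt1.
have missA := miss_threshold_le w0 P0_law P1_law (f + N%:R * c).
have := le_trans (delta_opt A mA A_eps) missA.
rewrite -[miss P1 delta]lnK ?posrE// ler_expR => ln_le.
rewrite expRK -[leRHS]mulrN ler_pdivlMl//.
have : N%:R * (N%:R^-1 * g) = g by rewrite mulrA mulfV ?mul1r// gt_eqF//.
nra.
Qed.

End exponent.

Theorem proposition2 (R : realType) (M : nat)
    (P : 'M[R]_M) (pi : 'rV[R]_M) (beta eps eta phi : R)
    (P0 P1 : forall N : nat, probability (data R M N) R)
    (delta : forall N : nat, set (data R M N))
    (d : nat -> measure_display) (T : forall N : nat, measurableType (d N))
    (Q : forall N : nat, probability (T N) R)
    (x : forall N : nat, N.-tuple 'I_M -> {RV (Q N) >-> R})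
    (P_stochastic : stochastic P)
    (P_irreducible : irreducible P)
    (P_aperiodic : aperiodic P)
    (pi_stationary : stationary P pi)
    (beta_gt0 : 0 < beta)
    (eps_gt0 : 0 < eps) (eps_lt1 : eps < 1)
    (P0_law : forall N, H0_law (P0 N))
    (P1_law : forall N, H1_law (path_prob P pi (N := N)) beta (P1 N))
    (delta_optimal : forall N, optimal_detector eps (P0 N) (P1 N) (delta N))
    (eta_def : - (N%:R^-1 * ln (miss (P1 N) (delta N))) @[N --> \oo] --> eta)
    (x_normal : forall N s, (0 < N)%N ->
       normally_distributed (x N s) 0 (Num.sqrt N%:R))
    (x_indep : forall N, (0 < N)%N -> mutually_independent (x N))
    (phi_def :
       ((N%:R^-1)%:E *
        'E_(Q N)[(fun t => ln (\sum_(s : N.-tuple 'I_M)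
                              path_prob P pi s * expR (beta * x N s t)))])%E
         @[N --> \oo] --> phi%:E) :
  beta ^+ 2 / 2 - phi <= eta.
Proof.
set u := fun N : nat => fine (N%:R^-1%:E *
  'E_(Q N)[(fun t => ln (\sum_(s : N.-tuple 'I_M)
                      path_prob P pi s * expR (beta * x N s t)))])%E.
(* The slack [c] introduced next is the excess of the threshold per column; it is removed only after
   the limit in N. *)
have u_phi : u N @[N --> \oo] --> phi by exact: fine_cvg phi_def.
rewrite lerBlDr -lerBlDl; apply/ler_addgt0Pr => c c0.
(* Chebyshev bounds the false alarm probability by K/N, hence by [eps] for large N. *)
pose K := beta ^+ 2 * (\int[normal 0 1]_v (v ^+ 2)) *+ M / c ^+ 2.
suff : beta ^+ 2 / 2 - c - phi <= eta by lra.
apply: (@ler_cvg_to _ _ _ _ (fun N => beta ^+ 2 / 2 - c - u N)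
  (fun N => - (N%:R^-1 * ln (miss (P1 N) (delta N)))) _ _ _ eta_def).
  by apply: cvgB => //; exact: cvg_cst.
near=> N.
(* The assumptions on [x N] are available only for positive [N]. *)
have N0 : (0 < N)%N by near: N; exact: nbhs_infty_gt.
have NR : 0 < N%:R :> R by rewrite ltr0n.
apply: (exponent_ge N0 _ c0 eps_lt1 (P0_law N) (P1_law N) (delta_optimal N)).
- by move=> s; exact: path_prob_ge0.
- by move=> s; exact: x_normal.
- exact: x_indep.
have -> : beta ^+ 2 * (\int[normal 0 1]_v (v ^+ 2)) *+ (M * N) / (N%:R * c) ^+ 2
    = K / N%:R.
  rewrite /K mulrnA -[in LHS]mulr_natr; field.
  by rewrite !gt_eqF.
rewrite ler_pdivrMr// mulrC -ler_pdivrMr//.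
near: N; exact: nbhs_infty_ger.
Unshelve. all: by end_near. Qed.
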